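(* The mapping $\mathcal P^k_{\mathrm{lam}}\to\mathbb R^{2^k-2}$ defined by $$\theta\mapsto\big(E^\theta(\mathsf U_2^S)\big)_{\emptyset\ne S\subsetneq[k]}$$ is injective.
   Context: **Unit tensors on subsets.** For $\emptyset\ne S\subsetneq[k]=\{1,\dots,k\}$, $\mathsf U_2^S=\sum_{i=1}^2(e_i\otimes\cdots\otimes e_i)_S\otimes(e_1\otimes\cdots\otimes e_1)_{\overline S}$ is the $k$-tensor with $e_i\in\mathbb C^2$ on the legs in $S$ and the fixed vector $e_1$ (in $\mathbb C^1$) on the legs in $\overline S=[k]\setminus S$. **Bipartitions.** $V=V_1\otimes\cdots\otimes V_k$, $V_i=\mathbb C^{d_i}$, $V_S=\bigotimes_{i\in S}V_i$. A bipartition of $[k]$ is an unordered pair $b=\{S,\overline S\}$ with $\emptyset\ne S\subsetneq[k]$. Two bipartitions $\{S,\overline S\}$, $\{T,\overline T\}$ are mutually laminar if there are $A\in\{S,\overline S\}$, $B\in\{T,\overline T\}$ with $A\subseteq B$; a set of bipartitions is laminar if its members are pairwise mutually laminar. $\mathcal P^k_{\mathrm{lam}}$ is the set of probability distributions on bipartitions of $[k]$ with laminar support. **Logarithmic upper quantum functional.** For $n\ge1$ and $\lambda\vdash n$, let $P_\lambda^{V_S}$ be the projector on $V^{\otimes n}\cong V_S^{\otimes n}\otimes V_{\overline S}^{\otimes n}$ onto the $\lambda$-isotypic component of the symmetric group $S_n$ permuting the factors of $V_S^{\otimes n}$ (acting trivially on $V_{\overline S}^{\otimes n}$), $P_{(n)}^{V_{[k]}}$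 the projector onto the symmetric subspace of $V^{\otimes n}$, and $P_\lambda^{V_b}=P_\lambda^{V_S}P_{(n)}^{V_{[k]}}$ for $b=\{S,\overline S\}$ (independent of the side; these commute for mutually laminar bipartitions). For $\theta\in\mathcal P^k_{\mathrm{lam}}$, $E^\theta(\psi)=\sup\sum_{b\in\mathrm{supp}\,\theta}\theta(b)H(\lambda^{(b)}/n)$ over all $n\ge1$ and tuples of partitions $\lambda^{(b)}\vdash n$ with $\big(\prod_{b\in\mathrm{supp}\,\theta}P^{V_b}_{\lambda^{(b)}}\big)\psi^{\otimes n}\ne0$, where $H$ is Shannon entropy (base 2). *)

(* Defs.v *)
From mathcomp Require Import all_boot all_order all_algebra all_fingroup.
From mathcomp Require Import mxrepresentation spectral.
From mathcomp Require Import complex.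
From mathcomp Require Import all_classical all_reals exp.

Set Implicit Arguments.
Unset Strict Implicit.
Unset Printing Implicit Defensive.

Import Order.TTheory GRing.Theory Num.Theory.
Local Open Scope ring_scope.
Local Open Scope complex_scope.

Definition is_partition_of (n : nat) (l : seq nat) : bool :=
  [&& sorted geq l, 0%N \notin l & sumn l == n].

Definition entropy (R : realType) (n : nat) (l : seq nat) : R :=
  - \sum_(m <- l) (m%:R / n%:R) * (ln (m%:R / n%:R) / ln 2).

(* Row and column stabilisers of the tableau of shape l filled with           *)
(* 0, ..., n-1 in reading order: the entry i lies in row (reshape_index l i)  *)
(* and in column (reshape_offset l i).                                        *)
Definition row_stab (n : nat) (l : seq nat) : {set {perm 'I_n}} :=
  [set s : {perm 'I_n} |
    [forall i : 'I_n, reshape_index l (s i) == reshape_index l i]].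

Definition col_stab (n : nat) (l : seq nat) : {set {perm 'I_n}} :=
  [set s : {perm 'I_n} |
    [forall i : 'I_n, reshape_offset l (s i) == reshape_offset l i]].

Definition young_symmetrizer (F : fieldType) (n : nat) (l : seq nat) :
    'M[F]_#|[set: {perm 'I_n}]%G| :=
  \sum_(p in row_stab n l) \sum_(q in col_stab n l)
     (-1) ^+ odd_perm q *: regular_repr F [set: {perm 'I_n}]%G (p * q)%g.

(* Modules in mxrepresentation are right modules; the Specht module is the    *)
(* right ideal of the group algebra generated by the Young symmetrizer.       *)
Definition specht_row (F : fieldType) (n : nat) (l : seq nat) :
    'rV[F]_#|[set: {perm 'I_n}]%G| :=
  gring_row (young_symmetrizer F n l).

Definition specht_repr (F : fieldType) (n : nat) (l : seq nat) :=
  submod_repr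
    (cyclic_mx_module (regular_repr F [set: {perm 'I_n}]%G)
       (specht_row F n l)).

(* The sum of all submodules of rG isomorphic to the Specht module of l; it   *)
(* is 0 when there is none, since component_mx rG 0 = 0.                      *)
Definition isotypic_mx (F : fieldType) (n m : nat)
    (rG : mx_representation F [set: {perm 'I_n}]%G m) (l : seq nat) : 'M[F]_m :=
  component_mx rG
    (xget 0 [set U : 'M[F]_m | exists modU : mxmodule rG U,
                                 mx_rsim (specht_repr F n l) (submod_repr modU)]).

(* Basis indices of V = V_1 (x) ... (x) V_k with dim V_i = d i, and of the    *)
(* n-th tensor power of V.                                                    *)
Notation tidx d := {dffun forall i, 'I_(d i)}.
Notation pidx n d := {ffun 'I_n -> tidx d}.

Definition tensor (R : realType) (k : nat) (d : 'I_k -> nat) :=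
  {ffun tidx d -> R[i]}.

Definition tensor_power (R : realType) (k : nat) (d : 'I_k -> nat)
    (n : nat) (psi : tensor R d) : 'rV[R[i]]_#|pidx n d| :=
  \row_a \prod_(j < n) psi ((enum_val a : pidx n d) j).

(* s moves the legs in S of the j-th copy of V to the (s j)-th copy.          *)
Definition leg_perm (k : nat) (d : 'I_k -> nat) (n : nat) (S : {set 'I_k})
    (s : {perm 'I_n}) (x : pidx n d) : pidx n d :=
  [ffun j => [ffun i => if i \in S then x ((s^-1)%g j) i else x j i]].

Definition leg_perm_mx (F : fieldType) (k : nat) (d : 'I_k -> nat) (n : nat)
    (S : {set 'I_k}) (s : {perm 'I_n}) : 'M[F]_#|pidx n d| :=
  \matrix_a delta_mx 0 (enum_rank (leg_perm S s (enum_val a))).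

Lemma leg_perm1 k (d : 'I_k -> nat) n S (x : pidx n d) : leg_perm S 1 x = x.
Proof.
apply/ffunP => j; apply/ffunP => i; rewrite !ffunE.
by rewrite invg1 perm1; case: ifP.
Qed.

Lemma leg_permM k (d : 'I_k -> nat) n S (s t : {perm 'I_n}) (x : pidx n d) :
  leg_perm S (s * t) x = leg_perm S t (leg_perm S s x).
Proof.
apply/ffunP => j; apply/ffunP => i; rewrite !ffunE.
by rewrite invMg permM; case: ifP.
Qed.

Lemma leg_perm_mx_repr (F : fieldType) k (d : 'I_k -> nat) n (S : {set 'I_k}) :
  mx_repr [set: {perm 'I_n}] (@leg_perm_mx F k d n S).
Proof.
split=> [|s t _ _]; apply/row_matrixP => a; rewrite ?row_mul !rowK.
  by rewrite leg_perm1 enum_valK row1.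
by rewrite -rowE rowK enum_rankK leg_permM.
Qed.

Definition leg_repr (F : fieldType) (k : nat) (d : 'I_k -> nat) (n : nat)
    (S : {set 'I_k}) : mx_representation F [set: {perm 'I_n}]%G #|pidx n d| :=
  MxRepresentation (@leg_perm_mx_repr F k d n S).

Definition proj_isotypic (R : realType) (k : nat) (d : 'I_k -> nat) (n : nat)
    (S : {set 'I_k}) (l : seq nat) : 'M[R[i]]_#|pidx n d| :=
  proj_ortho (isotypic_mx (leg_repr R[i] d n S) l).

Definition proj_sym (R : realType) (k : nat) (d : 'I_k -> nat) (n : nat) :
    'M[R[i]]_#|pidx n d| :=
  proj_ortho (rfix_mx (leg_repr R[i] d n [set: 'I_k]) [set: {perm 'I_n}]).

Definition is_bipartition (k : nat) (b : {set {set 'I_k}}) : bool :=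
  [exists S : {set 'I_k},
     [&& S != finset.set0, S != [set: 'I_k] & b == [set S; ~: S]%SET]].

Definition bipartition (k : nat) := {b : {set {set 'I_k}} | is_bipartition b}.

Definition laminar_pair (k : nat) (b c : bipartition k) : bool :=
  [exists A in val b, exists B in val c, A \subset B].

Definition bip_supp (R : realType) (k : nat) (theta : {ffun bipartition k -> R}) :
    {set bipartition k} :=
  [set b | theta b != 0]%SET.

Definition lam_distr (R : realType) (k : nat) : set {ffun bipartition k -> R} :=
  [set theta : {ffun bipartition k -> R} | [/\ forall b, 0 <= theta b, \sum_b theta b = 1 &
     {in bip_supp theta &, forall b c, laminar_pair b c}]]%classic.

(* One of the two sides of b; the choice does not affect proj_bip below.      *)
Definition side (k : nat) (b : bipartition k) : {set 'I_k} :=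
  xchoose (existsP (valP b)).

(* Operators act on row vectors from the right.                               *)
Definition proj_bip (R : realType) (k : nat) (d : 'I_k -> nat) (n : nat)
    (b : bipartition k) (l : seq nat) : 'M[R[i]]_#|pidx n d| :=
  proj_sym R d n *m proj_isotypic R d n (side b) l.

Definition upper_functional (R : realType) (k : nat) (d : 'I_k -> nat)
    (theta : {ffun bipartition k -> R}) (psi : tensor R d) : R :=
  sup [set h | exists (n : nat) (l : bipartition k -> seq nat),
    [/\ (0 < n)%N,
        {in bip_supp theta, forall b, is_partition_of n (l b)},
        tensor_power n psi *m
          \big[mulmx/1%:M]_(b in bip_supp theta) proj_bip R d n b (l b) != 0 &
        h = \sum_(b in bip_supp theta) theta b * entropy R n (l b)]]%classic.

Definition unit_dim (k : nat) (S : {set 'I_k}) (i : 'I_k) : nat :=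
  if i \in S then 2 else 1.

(* \sum_(e < 2) of the product tensor with the (0-based) basis vector e on    *)
(* the legs in S, and the basis vector 0 of the line on the other legs.       *)
Definition unit_tensor (R : realType) (k : nat) (S : {set 'I_k}) :
    tensor R (unit_dim S) :=
  [ffun x : tidx (unit_dim S) => \sum_(e < 2)
     \prod_(i < k) (x i == (if i \in S then e : nat else 0%N) :> nat)%:R].

Definition proper_subset (k : nat) :=
  {S : {set 'I_k} | (S != finset.set0) && (S != [set: 'I_k])}.

(* Main.v *)
Require Import Defs.
From mathcomp Require Import all_classical all_reals exp complex.
From mathcomp Require Import all_boot all_order all_algebra all_fingroup.
From mathcomp Require Import mxrepresentation spectral.
From mathcomp Require Import zify ring lra.

Set Implicit Arguments.
Unset Strict Implicit.
Unset Printing Implicit Defensive.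

Import Order.TTheory GRing.Theory Num.Theory.
Local Open Scope ring_scope.

(** The functional E^theta takes on the unit tensor U_2^S the value
    split_weight S theta, the total weight of the bipartitions both of whose
    sides meet S (upper_functional_unit).  Since the weights sum to 1, these
    values give, for every nonempty proper S,

      sum_T w(T) = 1 - E^theta(U_2^S),   w(T) = theta({T, ~T}),

    where T runs over the proper subsets that contain S, and descending
    induction on S recovers w, that is theta (split_weight_inj).

    Write psi for the n-th tensor power of U_2^S, and let pi_T be the action
    of S_n on the legs in T.

    Upper bound (upper_functional_elt_le).  Cut along T, the tensor U_2^S has
    rank 2 if T splits S and rank 1 otherwise, so psi is annihilated by every
    antisymmetrizer of 3, respectively 2, copies acting through pi_T
    (tensor_power_alt).  A shape with more rows than the rank has a column
    that is too long, and no nonzero vector of its isotypic component is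
    annihilated by all these antisymmetrizers (isotypic_alt_ker).  The
    annihilation survives the projectors of the other bipartitions: on
    symmetric vectors T may be exchanged with its complement (sym_alt_ker), and
    laminarity then lets T be chosen inside, or disjoint from, the side on
    which the projector acts (proj_alt_ker).  So a shape has at most 2 rows if
    its bipartition splits S, and is the single row otherwise; the entropies
    are at most 1, respectively 0.

    Lower bound (upper_functional_elt_ge).  For a splitting bipartition, most
    of psi lies in the components of the almost balanced shapes [n - j; j]:
    the part of psi orthogonal to all of them has squared norm at most a
    polynomial in n times the number of subsets of n points with few elements
    (good_part_norm), which is small against |psi|^2 = 2^n (small_sets_rare).
    By the triangle inequality the product over all bipartitions of the
    projectors onto the good components moves psi by less than its norm
    (hnrm_telescope), so some tuple of good shapes has a nonzero product of
    projectors (choose_factors).  The entropies of good shapes are as close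
    to 1 as desired.

    Both halves handle isotypic components through the Young symmetrizer
    y = R C: the component of shape l is V y C[S_n] (isotypic_mxE), which rests
    on y C[S_n] y being the line through y (young_sandwich), that is, on the
    combinatorics of tableaux (no_collision_factor). *)

(** * Rows and columns of the tableau *)

Section YoungCombinatorics.
Variables (n : nat) (l : seq nat).
Hypothesis nl : sumn l = n.

Lemma tableau_inj (i j : 'I_n) :
  reshape_index l i = reshape_index l j ->
  reshape_offset l i = reshape_offset l j -> i = j.
Proof.
move=> rij cij; apply: val_inj => /=.
by rewrite -(reshape_indexK l i) rij cij reshape_indexK.
Qed.

Lemma tableau_row_lt (i : 'I_n) : (reshape_index l i < size l)%N.
Proof. by apply: reshape_indexP; rewrite nl. Qed.

Lemma tableau_col_lt (i : 'I_n) :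
  (reshape_offset l i < nth 0%N l (reshape_index l i))%N.
Proof. by apply: reshape_offsetP; rewrite nl. Qed.

Lemma tableau_box r c : (c < nth 0 l r)%N ->
  exists2 i : 'I_n, reshape_index l i = r & reshape_offset l i = c.
Proof.
move=> lt_c; have lt_n : (flatten_index l r c < n)%N.
  have lt_r : (r < size l)%N.
    by rewrite ltnNge; apply: contraTN lt_c => /(nth_default 0%N)->.
  rewrite -nl -[X in (_ < sumn X)%N](cat_take_drop r l) sumn_cat ltn_add2l.
  by rewrite (drop_nth 0%N lt_r) /= ltn_addr.
by exists (Ordinal lt_n); rewrite /= ?flatten_indexKl ?flatten_indexKr.
Qed.

Lemma row_stabP (p : {perm 'I_n}) :
  reflect (forall i, reshape_index l (p i) = reshape_index l i)
          (p \in row_stab n l).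
Proof. by rewrite inE; apply: (iffP forallP) => H i; apply/eqP/H. Qed.

Lemma col_stabP (p : {perm 'I_n}) :
  reflect (forall i, reshape_offset l (p i) = reshape_offset l i)
          (p \in col_stab n l).
Proof. by rewrite inE; apply: (iffP forallP) => H i; apply/eqP/H. Qed.

Lemma row_stab_group_set : group_set (row_stab n l).
Proof.
apply/group_setP; split=> [|p q /row_stabP rp /row_stabP rq].
  by apply/row_stabP => i; rewrite perm1.
by apply/row_stabP => i; rewrite permM rq rp.
Qed.
Canonical row_stab_group := Group row_stab_group_set.

Lemma col_stab_group_set : group_set (col_stab n l).
Proof.
apply/group_setP; split=> [|p q /col_stabP rp /col_stabP rq].
  by apply/col_stabP => i; rewrite perm1.
by apply/col_stabP => i; rewrite permM rq rp.
Qed.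
Canonical col_stab_group := Group col_stab_group_set.

Lemma row_stab_tperm (i j : 'I_n) : reshape_index l i = reshape_index l j ->
  tperm i j \in row_stab n l.
Proof. by move=> ij; apply/row_stabP => k; case: tpermP => [->|->|]. Qed.

Lemma col_stab_tperm (i j : 'I_n) : reshape_offset l i = reshape_offset l j ->
  tperm i j \in col_stab n l.
Proof. by move=> ij; apply/col_stabP => k; case: tpermP => [->|->|]. Qed.

Lemma row_col_stab1 (p : {perm 'I_n}) :
  p \in row_stab n l -> p \in col_stab n l -> p = 1%g.
Proof.
move=> /row_stabP rp /col_stabP cp.
by apply/permP => i; rewrite perm1; apply: tableau_inj.
Qed.

Lemma card_row_box r m :
  #|[set i : 'I_n | (reshape_index l i == r) && (reshape_offset l i < m)%N]|
    = minn (nth 0 l r) m.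
Proof.
set A := [set _ | _].
have injA : {in A &, injective (fun i : 'I_n => reshape_offset l i)}.
  move=> i j; rewrite !inE => /andP[/eqP ri _] /andP[/eqP rj _].
  by apply: tableau_inj; rewrite ri rj.
have: perm_eq [seq reshape_offset l i | i : 'I_n in A] (iota 0 (minn (nth 0 l r) m)).
  apply: uniq_perm; rewrite ?iota_uniq //.
    rewrite map_inj_in_uniq ?enum_uniq // => i j.
    by rewrite !mem_enum; apply: injA.
  move=> c; rewrite mem_iota /= add0n leq_min; apply/imageP/andP.
    case=> i; rewrite inE => /andP[/eqP ri mi] ->; split=> //.
    by rewrite -ri tableau_col_lt.
  move=> [c1 c2]; have [i ri ci] := tableau_box c1.
  by exists i; rewrite ?inE ?ri ?ci ?eqxx.
by move/perm_size; rewrite size_image size_iota.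
Qed.

(** In a row no column is hit twice, so at most m boxes, and at most the whole
    row, land in the first m columns: as many as the tableau itself has
    there. *)
Lemma card_row_hit (h : {perm 'I_n}) r m :
  (forall i j : 'I_n, i != j -> reshape_index l i = reshape_index l j ->
     reshape_offset l (h i) <> reshape_offset l (h j)) ->
  (#|[set i : 'I_n | (reshape_index l i == r) && (reshape_offset l (h i) < m)%N]|
    <= minn (nth 0 l r) m)%N.
Proof.
move=> noc; rewrite leq_min; apply/andP; split.
  have -> : nth 0%N l r = minn (nth 0 l r) (nth 0 l r) by rewrite minnn.
  rewrite -card_row_box; apply: subset_leq_card; apply/subsetP => i.
  rewrite !inE => /andP[/eqP ri _]; rewrite ri eqxx /= -ri.
  exact: tableau_col_lt.
set A := [set _ | _].
rewrite -[X in (_ <= X)%N](size_iota 0) -(size_image (fun i => reshape_offset l (h i))).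
apply: uniq_leq_size.
  rewrite map_inj_in_uniq ?enum_uniq // => i j; rewrite !mem_enum !inE.
  move=> /andP[/eqP ri _] /andP[/eqP rj _] cij; apply/eqP/negPn/negP => ij.
  by apply: (noc i j ij) => //; rewrite ri rj.
move=> c cA.
case: (elimT (@imageP _ _ (fun i : 'I_n => reshape_offset l (h i)) A c) cA) => i.
rewrite inE => /andP[_ ci] ->.
by rewrite mem_iota.
Qed.

(** A permutation h that sends no two boxes of a row into one column hits the
    first m columns as often as the identity does, since h is a bijection.  Row
    by row it cannot do better than the identity (card_row_hit), so it does
    equally well in each row; m is taken to be the length of the row. *)
Lemma no_collision_fits (h : {perm 'I_n}) :
  (forall i j : 'I_n, i != j -> reshape_index l i = reshape_index l j ->
     reshape_offset l (h i) <> reshape_offset l (h j)) ->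
  forall i, (reshape_offset l (h i) < nth 0 l (reshape_index l i))%N.
Proof.
move=> noc i0; set r0 := reshape_index l i0; set m := nth 0%N l r0.
have split_rows (P : pred 'I_n) : #|[set i | P i]| =
    (\sum_(r < size l) #|[set i : 'I_n | (reshape_index l i == r) && P i]|)%N.
  pose f (i : 'I_n) : 'I_(size l) := Ordinal (tableau_row_lt i).
  rewrite -sum1_card (partition_big f xpredT) //=; apply: eq_bigr => r _.
  by rewrite -sum1_card; apply: eq_bigl => i; rewrite !inE andbC.
have tot : #|[set i : 'I_n | (reshape_offset l (h i) < m)%N]| =
           #|[set i : 'I_n | (reshape_offset l i < m)%N]|.
  rewrite -(card_preimset [set i : 'I_n | (reshape_offset l i < m)%N] (@perm_inj _ h)).
  by apply: eq_card => i; rewrite !inE.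
rewrite !split_rows in tot.
have hit r := card_row_hit r m noc.
have le r : true -> (#|[set i : 'I_n | (reshape_index l i == r) && (reshape_offset l (h i) < m)%N]|
   <= #|[set i : 'I_n | (reshape_index l i == r) && (reshape_offset l i < m)%N]|)%N.
  by move=> _; rewrite card_row_box.
pose R0 := Ordinal (tableau_row_lt i0).
have eqr0 : #|[set i : 'I_n | (reshape_index l i == r0) && (reshape_offset l (h i) < m)%N]|
   = #|[set i : 'I_n | (reshape_index l i == r0) && (reshape_offset l i < m)%N]|.
  apply/eqP; rewrite eqn_leq le //=.
  move: tot; rewrite (bigD1 R0) //= [RHS](bigD1 R0) //= => tot.
  rewrite -(leq_add2r (\sum_(i < size l | i != R0)
     #|[set i1 : 'I_n | (reshape_index l i1 == i) && (reshape_offset l (h i1) < m)%N]|)).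
  by rewrite tot leq_add2l; apply: leq_sum => r _; apply: le.
have sub : [set i : 'I_n | (reshape_index l i == r0) && (reshape_offset l (h i) < m)%N]
   \subset [set i : 'I_n | (reshape_index l i == r0) && (reshape_offset l i < m)%N].
  apply/subsetP => i; rewrite !inE => /andP[/eqP ri _]; rewrite ri eqxx /=.
  by rewrite /m -ri tableau_col_lt.
have/setP/(_ i0) : [set i : 'I_n | (reshape_index l i == r0) && (reshape_offset l (h i) < m)%N]
   = [set i : 'I_n | (reshape_index l i == r0) && (reshape_offset l i < m)%N].
  by apply/eqP; rewrite eqEcard sub eqr0 leqnn.
by rewrite !inE eqxx /= tableau_col_lt.
Qed.

(** The combinatorial core of Young's theory: move each box i along its row to
    the column of h i (possible by no_collision_fits); the rest of h preserves
    columns. *)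
Lemma no_collision_factor (h : {perm 'I_n}) :
  (forall i j : 'I_n, i != j -> reshape_index l i = reshape_index l j ->
     reshape_offset l (h i) <> reshape_offset l (h j)) ->
  exists p q, [/\ p \in row_stab n l, q \in col_stab n l & h = (p * q)%g].
Proof.
move=> noc; have fit := no_collision_fits noc.
have pf (i : 'I_n) : {k : 'I_n | reshape_index l k = reshape_index l i &
                       reshape_offset l k = reshape_offset l (h i)}.
  by apply: cid2; apply: tableau_box.
pose f i := s2val (pf i).
have fr i : reshape_index l (f i) = reshape_index l i by rewrite /f; case: (pf i).
have fc i : reshape_offset l (f i) = reshape_offset l (h i) by rewrite /f; case: (pf i).
have injf : injective f.
  move=> i j fij; apply/eqP/negPn/negP => ij.
  by apply: (noc i j ij); [rewrite -(fr i) -(fr j) fij | rewrite -(fc i) -(fc j) fij].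
exists (perm injf), ((perm injf)^-1 * h)%g; split.
- by apply/row_stabP => i; rewrite permE fr.
- apply/col_stabP => i; rewrite permM -{2}(permKV (perm injf) i).
  by rewrite (permE injf) fc.
- by rewrite mulKVg.
Qed.

End YoungCombinatorics.

(** * Young symmetrizers in a representation *)

Section YoungOperators.
Local Open Scope sesquilinear_scope.
Variables (C : numClosedFieldType) (n : nat).
Local Notation Sn := [set: {perm 'I_n}]%G.

Section Operators.
Variables (m : nat) (rG : mx_representation C Sn m) (l : seq nat).

Definition row_op : 'M[C]_m := \sum_(p in row_stab n l) rG p.
Definition col_op : 'M[C]_m :=
  \sum_(q in col_stab n l) (-1) ^+ odd_perm q *: rG q.
Definition young_op : 'M[C]_m := row_op *m col_op.

Lemma repr_permM s t : rG (s * t)%g = rG s *m rG t.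
Proof. by rewrite repr_mxM ?inE. Qed.

Lemma row_opMr p : p \in row_stab n l -> row_op *m rG p = row_op.
Proof.
move=> pr; rewrite mulmx_suml.
rewrite [RHS](reindex_inj (mulIg p)) /=; apply: eq_big => q.
  by rewrite (groupMr _ (pr : p \in row_stab_group n l)).
by rewrite repr_permM.
Qed.

Lemma col_opMl q : q \in col_stab n l ->
  rG q *m col_op = (-1) ^+ odd_perm q *: col_op.
Proof.
move=> qc; rewrite mulmx_sumr scaler_sumr.
rewrite [RHS](reindex_inj (mulgI q)) /=; apply: eq_big => p.
  by rewrite (groupMl _ (qc : q \in col_stab_group n l)).
move=> pc; rewrite repr_permM odd_permM signr_addb scalerA mulrA -expr2.
by rewrite sqrr_sign mul1r -scalemxAr.
Qed.

Lemma col_opMr q : q \in col_stab n l ->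
  col_op *m rG q = (-1) ^+ odd_perm q *: col_op.
Proof.
move=> qc; rewrite mulmx_suml scaler_sumr.
rewrite [RHS](reindex_inj (mulIg q)) /=; apply: eq_big => p.
  by rewrite (groupMr _ (qc : q \in col_stab_group n l)).
move=> pc; rewrite repr_permM odd_permM addbC signr_addb scalerA mulrA -expr2.
by rewrite sqrr_sign mul1r -scalemxAl.
Qed.

Lemma row_opM : row_op *m row_op = #|row_stab n l|%:R *: row_op.
Proof.
rewrite {2}/row_op mulmx_sumr scaler_nat -sumr_const.
by apply: eq_bigr => p; apply: row_opMr.
Qed.

Lemma mul_col_op0 p1 p2 (A : 'M_(p1, m)) (B : 'M_(m, p2)) :
  (forall q, A *m rG q *m B = 0) -> A *m col_op *m B = 0.
Proof.
move=> AB0; rewrite mulmx_sumr mulmx_suml big1 // => q _.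
by rewrite -scalemxAr -scalemxAl AB0 scaler0.
Qed.

Lemma mul_row_op0 p1 p2 (A : 'M_(p1, m)) (B : 'M_(m, p2)) :
  (forall p, A *m rG p *m B = 0) -> A *m row_op *m B = 0.
Proof. by move=> AB0; rewrite mulmx_sumr mulmx_suml big1. Qed.

Lemma col_opM : col_op *m col_op = #|col_stab n l|%:R *: col_op.
Proof.
rewrite {2}/col_op mulmx_sumr scaler_nat -sumr_const.
apply: eq_bigr => p pc; rewrite -scalemxAr col_opMr // scalerA -expr2.
by rewrite sqrr_sign scale1r.
Qed.

(** The submodule V y C[S_n], for V the whole space; it is the isotypic
    component of the shape, see isotypic_mxE. *)
Definition young_span : 'M[C]_m :=
  (\sum_(h : {perm 'I_n}) (young_op *m rG h))%MS.

Lemma young_span_module : mxmodule rG young_span.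
Proof.
apply/mxmoduleP => x _; rewrite sumsmxMr; apply/sumsmx_subP => h _.
by rewrite -mulmxA -repr_permM (sumsmx_sup (h * x)%g).
Qed.

Lemma mxmodule_young p1 p2 (U : 'M_(p1, m)) (W : 'M_(p2, m)) :
  mxmodule rG U -> (W <= U)%MS -> (W *m young_op <= U)%MS.
Proof.
move=> modU WU; rewrite mulmxA mulmx_sumr summx_sub // => q _.
rewrite -scalemxAr scalemx_sub // mxmodule_trans ?inE //.
by rewrite mulmx_sumr summx_sub // => p _; rewrite mxmodule_trans ?inE.
Qed.

Lemma young_sub_span p (W : 'M_(p, m)) h : (W *m young_op *m rG h <= young_span)%MS.
Proof. by rewrite -mulmxA (sumsmx_sup h) ?submxMl. Qed.

Lemma young_span_stable A : (forall h, A *m rG h = rG h *m A) ->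
  (young_span *m A <= young_span)%MS.
Proof.
move=> cA; rewrite sumsmxMr; apply/sumsmx_subP => h _.
have cC : col_op *m A = A *m col_op.
  rewrite mulmx_sumr mulmx_suml; apply: eq_bigr => q _.
  by rewrite -scalemxAr -scalemxAl cA.
have cR : row_op *m A = A *m row_op.
  by rewrite mulmx_sumr mulmx_suml; apply: eq_bigr => q _; rewrite cA.
have cY : young_op *m A = A *m young_op.
  by rewrite /young_op -mulmxA cC mulmxA cR -mulmxA.
by rewrite -mulmxA -cA mulmxA cY (sumsmx_sup h) // -mulmxA submxMl.
Qed.
End Operators.

(** The transposition of two boxes of one row that h sends to one column is
    absorbed by R on the left with sign 1 and, carried through h, by C on the
    right with sign -1. *)
Lemma row_col_collision m (rG : mx_representation C Sn m) l mu (h : {perm 'I_n}) (i j : 'I_n) :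
  i != j -> reshape_index l i = reshape_index l j ->
  reshape_offset mu (h i) = reshape_offset mu (h j) ->
  row_op rG l *m rG h *m col_op rG mu = 0.
Proof.
move=> ij rij cij; set X := (X in X = 0).
suff: X = - X by move/eqP; rewrite -addr_eq0 -mulr2n -scaler_nat scaler_eq0 pnatr_eq0 => /eqP.
rewrite {1}/X -(row_opMr rG (row_stab_tperm rij)) -[_ *m rG h]mulmxA -repr_permM.
have -> : (tperm i j * h = h * tperm (h i) (h j))%g by rewrite -tpermJ conjgC.
rewrite repr_permM !mulmxA -[X in X = _]mulmxA col_opMl ?col_stab_tperm //.
by rewrite odd_tperm (inj_eq perm_inj) ij scaleN1r mulmxN.
Qed.

(** The scalar is 0 or a sign, and depends on h alone: it is the same in all
    representations, which allows constants computed in the regular one to be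
    used in any other. *)
Lemma row_col_scalar l h : sumn l = n ->
  exists e : C, forall m (rG : mx_representation C Sn m),
    row_op rG l *m rG h *m col_op rG l = e *: young_op rG l.
Proof.
move=> nl.
have [/existsP[i /existsP[j /and3P[ij /eqP rij /eqP cij]]]|noc] := boolP
  [exists i : 'I_n, exists j : 'I_n, [&& i != j,
     reshape_index l i == reshape_index l j &
     reshape_offset l (h i) == reshape_offset l (h j)]].
  by exists 0 => m rG; rewrite (row_col_collision rG ij rij cij) scale0r.
have [|p [q [pr qc ->]]] := @no_collision_factor n l nl h.
  move=> i j ij rij /eqP cij; move: noc => /existsPn/(_ i)/existsPn/(_ j).
  by rewrite ij rij eqxx cij.
exists ((-1) ^+ odd_perm q) => m rG.
by rewrite repr_permM mulmxA row_opMr // -mulmxA col_opMl // -scalemxAr.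
Qed.

Lemma young_sandwich l h : sumn l = n ->
  exists e : C, forall m (rG : mx_representation C Sn m),
    young_op rG l *m rG h *m young_op rG l = e *: young_op rG l.
Proof.
move=> nl; have [e eP] := boolp.choice (fun h => @row_col_scalar l h nl).
exists (\sum_(q in col_stab n l) \sum_(p in row_stab n l)
          (-1) ^+ odd_perm q * e (q * h * p)%g) => m rG.
have -> : young_op rG l *m rG h *m young_op rG l =
    row_op rG l *m (col_op rG l *m rG h *m row_op rG l) *m col_op rG l.
  by rewrite /young_op !mulmxA.
have -> : col_op rG l *m rG h *m row_op rG l =
    \sum_(q in col_stab n l) \sum_(p in row_stab n l)
       (-1) ^+ odd_perm q *: rG (q * h * p)%g.
  rewrite !mulmx_suml; apply: eq_bigr => q _; rewrite mulmx_sumr.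
  by apply: eq_bigr => p _; rewrite -!scalemxAl !repr_permM.
have aux (A B : 'M[C]_m) (F : {perm 'I_n} -> {perm 'I_n} -> 'M[C]_m) :
    A *m (\sum_(q in col_stab n l) \sum_(p in row_stab n l) F q p) *m B
    = \sum_(q in col_stab n l) \sum_(p in row_stab n l) A *m F q p *m B.
  rewrite mulmx_sumr mulmx_suml; apply: eq_bigr => q _.
  by rewrite mulmx_sumr mulmx_suml.
rewrite aux scaler_suml; apply: eq_bigr => q _.
rewrite scaler_suml; apply: eq_bigr => p _.
by rewrite -scalerA -eP -scalemxAr -scalemxAl.
Qed.

Lemma trC_mul p q r (A : 'M[C]_(p, q)) (B : 'M_(q, r)) :
  (A *m B)^t* = B^t* *m A^t*.
Proof. by rewrite trmx_mul map_mxM. Qed.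

(** The entries of M M^* on the diagonal are the squared norms of the rows. *)
Lemma mulmx_trC_eq0 p q (M : 'M[C]_(p, q)) : M *m M^t* = 0 -> M = 0.
Proof.
move=> MM; apply/row_matrixP => i; rewrite row0; apply/eqP.
rewrite -(dnorm_eq0 (@dotmx C q)) /= dotmxE mxE.
have /matrixP/(_ i i) := MM; rewrite !mxE => MMi; apply/eqP; rewrite -[RHS]MMi.
by apply: eq_bigr => k _; rewrite !mxE.
Qed.

Definition unitary_repr m (rG : mx_representation C Sn m) :=
  forall g, (rG g)^t* = rG g^-1%g.

Section Unitary.
Variables (m : nat) (rG : mx_representation C Sn m) (l : seq nat).
Hypothesis uG : unitary_repr rG.

Lemma row_op_trC : (row_op rG l)^t* = row_op rG l.
Proof.
rewrite linear_sum /= map_mx_sum (reindex_inj invg_inj) /=.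
apply: eq_big => [p|p _]; last by rewrite uG invgK.
by rewrite (groupV (row_stab_group n l)).
Qed.

Lemma col_op_trC : (col_op rG l)^t* = col_op rG l.
Proof.
rewrite linear_sum /= map_mx_sum (reindex_inj invg_inj) /=.
apply: eq_big => [p|p _]; first by rewrite (groupV (col_stab_group n l)).
by rewrite linearZ /= map_mxZ uG invgK odd_permV rmorph_sign.
Qed.

Lemma young_op_trC : (young_op rG l)^t* = col_op rG l *m row_op rG l.
Proof. by rewrite trC_mul row_op_trC col_op_trC. Qed.

(** For M = Y Y^*, positivity gives M M^* <> 0 as soon as Y <> 0, hence
    Y Y^* Y <> 0; but Y^* = C R, and R C C R R C is a multiple of Y Y. *)
Lemma young_op_sqr_neq0 : young_op rG l != 0 -> young_op rG l *m young_op rG l != 0.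
Proof.
set Y := young_op rG l => nzY; apply: contra_neq nzY => YY0.
apply: mulmx_trC_eq0; apply: mulmx_trC_eq0.
rewrite (trC_mul Y (Y^t*)) trmxCK mulmxA.
rewrite (_ : Y *m Y^t* *m Y = 0) ?mul0mx //.
rewrite young_op_trC {1 2}/Y /young_op.
have -> : row_op rG l *m col_op rG l *m (col_op rG l *m row_op rG l) *m
   (row_op rG l *m col_op rG l) = row_op rG l *m (col_op rG l *m col_op rG l) *m
   (row_op rG l *m row_op rG l) *m col_op rG l by rewrite !mulmxA.
rewrite col_opM row_opM -!(scalemxAr, scalemxAl).
have -> : row_op rG l *m col_op rG l *m row_op rG l *m col_op rG l = Y *m Y.
  by rewrite /Y /young_op !mulmxA.
by rewrite YY0 !scaler0.
Qed.
End Unitary.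

Lemma regular_unitary : unitary_repr (regular_repr C Sn).
Proof.
move=> g; apply/matrixP => i j; rewrite !mxE eqxx /= rmorph_nat; congr (_%:R).
by congr nat_of_bool; apply/eqP/eqP => ->;
  rewrite gring_indexK ?inE // ?mulgK ?mulgKV gring_valK.
Qed.

Lemma young_symmetrizerE l : young_symmetrizer C n l = young_op (regular_repr C Sn) l.
Proof.
rewrite /young_op /row_op /col_op mulmx_suml; apply: eq_bigr => p _.
rewrite mulmx_sumr; apply: eq_bigr => q _.
by rewrite -scalemxAr -repr_permM.
Qed.

(** The coefficient of the identity in y is 1, because only the identity
    preserves both rows and columns. *)
Lemma specht_row_neq0 l : sumn l = n -> specht_row C n l != 0.
Proof.
move=> nl; apply/eqP => s0.
have : gring_proj 1 (young_symmetrizer C n l) = 0 :> 'M_1.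
  by rewrite /gring_proj /= -/(specht_row C n l) s0 !linear0.
rewrite linear_sum (bigD1 1%g) /=; last by rewrite (group1 (row_stab_group n l)).
rewrite linear_sum (bigD1 1%g) /=; last by rewrite (group1 (col_stab_group n l)).
rewrite linearZ /= gring_projE ?inE // mulg1 eqxx odd_perm1 scale1r.
rewrite big1 ?addr0 => [|q /andP[qc q1]]; last first.
  by rewrite linearZ /= gring_projE ?inE // mul1g eq_sym (negPf q1) scaler0.
rewrite big1 ?addr0 => [|p /andP[pr p1]]; last first.
  rewrite linear_sum big1 // => q qc; rewrite linearZ /= gring_projE ?inE //.
  case: eqP => [pq|]; last by rewrite scaler0.
  case/eqP: p1; apply: (row_col_stab1 pr).
  have -> : p = q^-1%g by apply: (mulIg q); rewrite -pq mulVg.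
  by rewrite (groupV (col_stab_group n l)).
by move/matrixP/(_ 0 0); rewrite !mxE; apply/eqP; rewrite oner_eq0.
Qed.

Lemma young_op_regular_neq0 l : sumn l = n -> young_op (regular_repr C Sn) l != 0.
Proof.
move=> nl; apply: contra_neq (specht_row_neq0 nl) => Y0.
by rewrite /specht_row young_symmetrizerE Y0 linear0.
Qed.

(** The scalar in y y = c y is nonzero because it is so in the regular
    representation, where y does not vanish. *)
Lemma young_op_sqr l : sumn l = n ->
  exists2 c : C, c != 0 & forall m (rG : mx_representation C Sn m),
    young_op rG l *m young_op rG l = c *: young_op rG l.
Proof.
move=> nl; have [c cP] := @young_sandwich l 1%g nl.
have {}cP m (rG : mx_representation C Sn m) :
    young_op rG l *m young_op rG l = c *: young_op rG l.
  by rewrite -cP repr_mx1 mulmx1.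
exists c => //; apply: contraNneq (young_op_sqr_neq0 regular_unitary (young_op_regular_neq0 nl)).
by move=> c0; rewrite cP c0 scale0r.
Qed.

(** If y annihilated all translates of w, then so would y^* = C R: indeed
    y^* y^* is a nonzero multiple of y^*, and w h y^* y^* = (w h C) y R where
    w h C is a combination of translates of w.  But then w would be orthogonal
    to every v y h, that is to the span it belongs to. *)
Lemma young_span_neq0 m (rG : mx_representation C Sn m) l (w : 'rV_m) :
  unitary_repr rG -> sumn l = n -> (w <= young_span rG l)%MS -> w != 0 ->
  exists h, w *m rG h *m young_op rG l != 0.
Proof.
move=> uG nl wI; apply: contra_neqP => noh.
have {noh} noh h : w *m rG h *m young_op rG l = 0.
  by apply/eqP/negPn/negP => nz; case: noh; exists h.
have [c c0 cP] := young_op_sqr nl.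
have noh' h : w *m rG h *m (col_op rG l *m row_op rG l) = 0.
  have: c^* *: (w *m rG h *m (col_op rG l *m row_op rG l)) = 0.
    have -> : c^* *: (w *m rG h *m (col_op rG l *m row_op rG l)) =
        w *m rG h *m ((young_op rG l) *m (young_op rG l))^t*.
      by rewrite cP linearZ /= map_mxZ /= young_op_trC // -scalemxAr.
    rewrite trC_mul young_op_trC // mulmxA.
    have -> : w *m rG h *m (col_op rG l *m row_op rG l *m col_op rG l *m row_op rG l)
       = w *m rG h *m col_op rG l *m young_op rG l *m row_op rG l.
      by rewrite /young_op !mulmxA.
    rewrite mul_col_op0 ?mul0mx // => q.
    by rewrite -[w *m _ *m _]mulmxA -repr_permM noh.
  by move/eqP; rewrite scaler_eq0 conjC_eq0 (negPf c0) => /eqP.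
have /sub_sumsmxP[u wE] := wI.
apply: mulmx_trC_eq0; rewrite {2}wE linear_sum /= map_mx_sum mulmx_sumr big1 // => h _.
rewrite 2!trC_mul uG young_op_trC // !mulmxA -[w *m _ *m _ *m _]mulmxA.
by rewrite noh' mul0mx.
Qed.

End YoungOperators.

(** * Specht modules and isotypic components *)

Section Specht.
Local Open Scope sesquilinear_scope.
Variables (C : numClosedFieldType) (n : nat) (l : seq nat).
Hypothesis nl : sumn l = n.
Local Notation Sn := [set: {perm 'I_n}]%G.
Local Notation incl U := (val_submod (1%:M : 'M_(\rank U))).
Local Notation aG := (regular_repr C Sn).
Local Notation S := (cyclic_mx aG (specht_row C n l)).
Local Notation modS := (cyclic_mx_module aG (specht_row C n l)).

Lemma specht_rowE : specht_row C n l = gring_row 1%:M *m young_op aG l.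
Proof. by rewrite /specht_row young_symmetrizerE -[in LHS](mul1mx (young_op _ _)) gring_row_mul. Qed.

Lemma young_envelop A : (A \in enveloping_algebra_mx aG)%MS ->
  exists e : C, young_op aG l *m A *m young_op aG l = e *: young_op aG l.
Proof.
case/envelop_mxP=> a ->.
have [e eP] := boolp.choice (fun h => @young_sandwich C n l h nl).
exists (\sum_(h in Sn) a h * e h).
rewrite mulmx_sumr mulmx_suml scaler_suml; apply: eq_bigr => h _.
by rewrite -scalemxAr -scalemxAl eP scalerA.
Qed.

(** A nonzero submodule U of y C[S_n] contains, by young_span_neq0, an element
    x h y <> 0; it is a multiple of y by young_sandwich. *)
Lemma specht_simple : mxsimple aG S.
Proof.
split; first exact: modS.
  by rewrite cyclic_mx_eq0 specht_row_neq0.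
move=> U modU US /rowV0Pn[x xU x0].
apply: cyclic_mx_sub => //.
have [A EA xE] := cyclic_mxP (submx_trans xU US).
have xI : (x <= young_span aG l)%MS.
  rewrite xE specht_rowE; case/envelop_mxP: EA => a ->.
  rewrite mulmx_sumr summx_sub // => h _.
  by rewrite -scalemxAr scalemx_sub // young_sub_span.
have [h nz] := young_span_neq0 (@regular_unitary C n) nl xI x0.
have [|e eP] := @young_envelop (A *m aG h).
  by rewrite envelop_mxM // envelop_mx_id ?inE.
have xhY : x *m aG h *m young_op aG l = e *: specht_row C n l.
  by rewrite xE specht_rowE scalemxAr -eP !mulmxA.
have e0 : e != 0 by apply: contraNneq nz => e0; rewrite xhY e0 scale0r.
have -> : specht_row C n l = e^-1 *: (x *m aG h *m young_op aG l).
  by rewrite xhY scalerA mulVf // scale1r.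
by rewrite scalemx_sub // mxmodule_young // mxmodule_trans ?inE.
Qed.

Section Rep.
Variables (m : nat) (rG : mx_representation C Sn m).

Lemma young_op_hom m1 m2 (r1 : mx_representation C Sn m1)
    (r2 : mx_representation C Sn m2) B :
  (forall x, r1 x *m B = B *m r2 x) ->
  young_op r1 l *m B = B *m young_op r2 l.
Proof.
move=> hB; have hR : row_op r1 l *m B = B *m row_op r2 l.
  by rewrite mulmx_suml mulmx_sumr; apply: eq_bigr.
have hC : col_op r1 l *m B = B *m col_op r2 l.
  rewrite mulmx_suml mulmx_sumr; apply: eq_bigr => q _.
  by rewrite -scalemxAl -scalemxAr hB.
by rewrite /young_op -mulmxA hC mulmxA hR mulmxA.
Qed.

Lemma val_submod_hom m1 (r1 : mx_representation C Sn m1) (U : 'M_m1)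
    (modU : mxmodule r1 U) x :
  submod_repr modU x *m incl U = incl U *m r1 x.
Proof. by rewrite -val_submodE -val_submodJ ?inE // mul1mx. Qed.

(** The map a |-> v a restricts to the Specht module as a homomorphism sending
    y to v y; it is injective there by simplicity. *)
Lemma specht_embed (v : 'rV_m) : v *m young_op rG l != 0 ->
  exists2 U : 'M_m, (v *m young_op rG l <= U)%MS &
    exists modU : mxmodule rG U, mx_rsim (specht_repr C n l) (submod_repr modU).
Proof.
move=> vY0.
pose f : 'M[C]_(#|Sn|, m) := enveloping_algebra_mx rG *m lin_mul_row v.
have fE a : a *m f = v *m gring_mx rG a.
  by rewrite /f mulmxA mul_rV_lin1 /= /gring_mx /=.
have fJ p (W : 'M_(p, _)) x : W *m aG x *m f = W *m f *m rG x.
  apply/row_matrixP => i; rewrite !row_mul !fE gring_mxJ ?inE //.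
  by rewrite mulmxA.
have sf : specht_row C n l *m f = v *m young_op rG l.
  rewrite specht_rowE -mulmxA (@young_op_hom _ _ aG rG f); last first.
    by move=> x; rewrite -[RHS]mul1mx mulmxA -fJ mul1mx.
  by rewrite mulmxA fE -gring_opE gring_op1 mulmx1.
have ker0 : (S :&: kermx f)%MS = 0.
  apply/eqP/negPn/negP => nz; have [_ _ simS] := specht_simple.
  have modK : mxmodule aG (S :&: kermx f)%MS.
    apply/mxmoduleP => x _; rewrite sub_capmx; apply/andP; split.
      by rewrite mxmodule_trans ?capmxSl ?modS ?inE.
    apply/sub_kermxP; rewrite fJ (sub_kermxP (capmxSr _ _)) mul0mx //.
  have SK := simS _ modK (capmxSl _ _) nz.
  have : (specht_row C n l <= kermx f)%MS.
    apply: submx_trans (cyclic_mx_id aG _) _; apply: submx_trans SK _.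
    exact: capmxSr.
  by move/sub_kermxP; rewrite sf => /eqP; apply/negP.
have rkS : \rank (S *m f) = \rank S.
  by rewrite -(mxrank_mul_ker S f) ker0 mxrank0 addn0.
pose U : 'M_m := <<S *m f>>%MS.
have UE : (U :=: S *m f)%MS by apply: genmxE.
have modU : mxmodule rG U.
  apply/mxmoduleP => x _; rewrite (eqmxMr _ UE) UE -fJ submxMr //.
  by rewrite mxmodule_trans ?modS ?inE.
exists U; first by rewrite UE -sf submxMr ?cyclic_mx_id.
exists modU; exists (in_submod U (incl S *m f)).
- by rewrite UE rkS.
- rewrite /row_free mxrank_in_submod ?UE ?submxMr ?val_submodP //.
  by rewrite (eqmxMr f (val_submod1 S)) rkS.
- move=> x _; rewrite -in_submodJ; last by rewrite UE submxMr ?val_submodP.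
  rewrite -fJ -(val_submod_hom modS) -mulmxA [RHS]in_submodE.
  by rewrite [in_submod U (incl S *m f)]in_submodE !mulmxA.
Qed.

(** The image v of y under an isomorphism onto V satisfies v y = c v, so v lies
    in the span, and v generates V. *)
Lemma specht_sub_span (V : 'M_m) (modV : mxmodule rG V) :
  mx_rsim (specht_repr C n l) (submod_repr modV) -> mxsimple rG V ->
  (V <= young_span rG l)%MS.
Proof.
case=> B _ freeB homB simV.
have [c c0 cP] := young_op_sqr C nl.
pose s0 := in_submod S (specht_row C n l).
have s0E : s0 *m incl S = specht_row C n l.
  by rewrite -val_submodE in_submodK ?cyclic_mx_id.
have s0Y : s0 *m young_op (specht_repr C n l) l = c *: s0.
  apply: (@val_submod_inj _ _ S); rewrite val_submodE [RHS]val_submodE.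
  rewrite -scalemxAl -mulmxA (young_op_hom (val_submod_hom modS)) mulmxA s0E.
  by rewrite specht_rowE -mulmxA cP -scalemxAr.
pose v := s0 *m B *m incl V.
have v0 : v != 0.
  rewrite /v -val_submodE val_submod_eq0 mulmx_free_eq0 //.
  apply: contra_neq (specht_row_neq0 C nl) => s00.
  by rewrite -s0E s00 mul0mx.
have vV : (v <= V)%MS by rewrite /v -val_submodE val_submodP.
have vY : v *m young_op rG l = c *: v.
  rewrite /v -(mulmxA _ _ (young_op _ _)) -(young_op_hom (val_submod_hom modV)).
  rewrite mulmxA (_ : s0 *m B *m _ = c *: (s0 *m B)) ?scalemxAl //.
  rewrite -mulmxA -(@young_op_hom _ _ (specht_repr C n l)) => [|x].
    by rewrite mulmxA s0Y scalemxAl.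
  by rewrite homB ?inE.
rewrite (mxsimple_cyclic simV v0 vV) cyclic_mx_sub ?young_span_module //.
have -> : v = c^-1 *: (v *m young_op rG l *m rG 1%g).
  by rewrite repr_mx1 mulmx1 vY scalerA mulVf // scale1r.
by rewrite scalemx_sub // young_sub_span.
Qed.

Lemma rsim_specht_simple (V : 'M_m) (modV : mxmodule rG V) :
  mx_rsim (specht_repr C n l) (submod_repr modV) -> mxsimple rG V.
Proof.
move=> sim; apply/(submod_mx_irr modV); apply: mx_rsim_irr sim _.
by apply/submod_mx_irr; apply: specht_simple.
Qed.

(** One inclusion holds because each vector v y <> 0 generates a copy of the
    Specht module; if there is no copy, both sides vanish. *)
Lemma isotypic_mxE : (isotypic_mx rG l :=: young_span rG l)%MS.
Proof.
have young_row i h : row i (young_op rG l *m rG h) = delta_mx 0 i *m young_op rG l *m rG h.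
  by rewrite row_mul rowE.
rewrite /isotypic_mx; set P := (X in xget 0 X).
have [exP|noP] := boolp.pselect (exists U, P U); last first.
  rewrite xgetPN; last by move=> U PU; apply: noP; exists U.
  have -> : component_mx rG 0 = 0.
    apply/eqP; rewrite -submx0 /component_mx locked_withE /component_mx_expr; apply/sumsmx_subP => i _.
    rewrite submx0 cyclic_mx_eq0; apply/eqP.
    have /row_hom_mxP[f _ <-] := row_sub i (row_hom_mx rG (nz_row (0 : 'M_m))).
    suff -> : nz_row (0 : 'M[C]_m) = 0 by rewrite mul0mx.
    by apply/eqP; rewrite nz_row_eq0.
  apply/eqmx_sym/eqmxP; rewrite sub0mx andbT; apply/sumsmx_subP => h _.
  apply/row_subP => i; rewrite young_row.
  have [->|nz] := eqVneq ((delta_mx 0 i : 'rV_m) *m young_op rG l) 0; first by rewrite mul0mx sub0mx.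
  by have [V _ PV] := specht_embed nz; case: noP; exists V.
have := xgetPex 0 exP; move: (xget 0 P) => U [modU simU].
have simpU := rsim_specht_simple simU.
apply/eqmxP/andP; split.
  have [I [W isoW ->]] := component_mx_def simpU.
  apply/sumsmx_subP => i _.
  have simW := mx_iso_simple (isoW i) simpU.
  apply: (@specht_sub_span _ (mxsimple_module simW)) => //.
  by apply: mx_rsim_trans simU _; apply/mx_rsim_iso.
apply/sumsmx_subP => h _; apply/row_subP => i; rewrite young_row.
have [->|nz] := eqVneq ((delta_mx 0 i : 'rV_m) *m young_op rG l) 0; first by rewrite mul0mx sub0mx.
have [V vV [modV simV]] := specht_embed nz.
rewrite mxmodule_trans ?component_mx_module ?inE //.
apply: submx_trans vV _; apply: mx_iso_component simpU _ _.
apply/(mx_rsim_iso modU modV); apply: mx_rsim_trans simV.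
exact: mx_rsim_sym.
Qed.
End Rep.
End Specht.

(** * Orthogonal projections *)

Section OrthoProj.
Local Open Scope sesquilinear_scope.
Variables (C : numClosedFieldType) (m : nat).
Implicit Types (U A : 'M[C]_m) (v : 'rV[C]_m).
Local Notation "B ^!" :=
  (orthomx Num.Def.conjC (mx_of_hermitian (hermitian1mx _)) B) : matrix_set_scope.
Local Notation "''[' u ]" := (dotmx u u) : ring_scope.

Lemma trCB p q (A B : 'M[C]_(p, q)) : (A - B)^t* = A^t* - B^t*.
Proof. by apply/matrixP => i j; rewrite !mxE rmorphB. Qed.

(** A space stable under A and A^* has an orthogonal complement stable under
    A. *)
Lemma proj_ortho_commute U A :
  (U *m A <= U)%MS -> (U *m A^t* <= U)%MS ->
  A *m proj_ortho U = proj_ortho U *m A.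
Proof.
move=> UA UAs; set P := proj_ortho U.
rewrite -{1}(mul1mx A) -(subrK P 1%:M) mulmxDl mulmxDl.
rewrite [X in X + _](_ : _ = 0) ?add0r; last first.
  apply: proj_ortho_0; apply/orthomx1P.
  have /submxP[X UX] := UAs.
  have Qorth : (1%:M - P) *m U^t* = 0.
    by apply/orthomx1P; rewrite -[X in _ - X]mul1mx proj_ortho_compl_sub.
  have -> : (1%:M - P) *m A *m U^t* = (1%:M - P) *m (U *m A^t*)^t*.
    by rewrite trC_mul trmxCK mulmxA.
  by rewrite UX trC_mul mulmxA Qorth mul0mx.
by rewrite proj_ortho_id // (submx_trans (submxMr A _) UA) // proj_orthoE.
Qed.

Lemma proj_ortho_trC U : (proj_ortho U)^t* = proj_ortho U.
Proof.
set P := proj_ortho U.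
have PQ : P *m (1%:M - P)^t* = 0.
  apply/orthomx1P; rewrite orthomx_sym; apply: submx_trans (_ : (1%:M - P <= U^!)%MS) _.
    by rewrite -[X in _ - X]mul1mx proj_ortho_compl_sub.
  by rewrite submx_ortho proj_orthoE.
have PP : P = P *m P^t*.
  apply/eqP; rewrite -subr_eq0 -{1}[P]mulmx1 -mulmxBr -PQ; apply/eqP.
  by rewrite trCB trmx1 map_mx1.
by rewrite PP trC_mul trmxCK.
Qed.

Definition contraction A := forall v, '[v *m A] <= '[v].

Lemma proj_herm_contraction (P : 'M[C]_m) : P *m P = P -> P^t* = P -> contraction P.
Proof.
move=> PP Ph v.
have -> : '[v] = '[v *m P] + '[v - v *m P].
  rewrite -hnormDd; first by rewrite addrC subrK.
  rewrite -[LHS]/(dotmx _ _) dotmxE trCB trC_mul Ph mulmxBr mulmxA -(mulmxA v P P) PP.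
  by rewrite subrr mxE.
by rewrite lerDl dnorm_ge0.
Qed.

Lemma proj_ortho_contraction U : contraction (proj_ortho U).
Proof. exact: proj_herm_contraction (proj_ortho_proj _) (proj_ortho_trC _). Qed.

Lemma contractionM A B : contraction A -> contraction B -> contraction (A *m B).
Proof. by move=> cA cB v; rewrite mulmxA (le_trans (cB _)). Qed.

Lemma contraction1 : contraction 1%:M.
Proof. by move=> v; rewrite mulmx1. Qed.

Lemma contraction_prod (I : Type) (s : seq I) (A : I -> 'M[C]_m) :
  (forall i, contraction (A i)) -> contraction (\big[mulmx/1%:M]_(i <- s) A i).
Proof.
move=> cA; elim: s => [|i s IH]; rewrite ?big_nil ?big_cons.
  exact: contraction1.
exact: contractionM.
Qed.

Definition hnrm v : C := sqrtC '[v].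

Lemma hnrmD u v : hnrm (u + v) <= hnrm u + hnrm v.
Proof. by have [] := triangle_lerif (@dotmx C m) u v. Qed.

Lemma hnrm_contraction A v : contraction A -> hnrm (v *m A) <= hnrm v.
Proof. by move=> cA; rewrite ler_sqrtC ?qualifE /= ?dnorm_ge0. Qed.

(** The factors need not commute: v - v A B = (v - v A) B + (v - v B), and
    contractions do not increase the first summand. *)
Lemma hnrm_telescope (I : Type) (s : seq I) (A : I -> 'M[C]_m) v (d : C) :
  (forall i, contraction (A i)) -> (forall i, hnrm (v - v *m A i) <= d) ->
  hnrm (v - v *m \big[mulmx/1%:M]_(i <- s) A i) <= (size s)%:R * d.
Proof.
move=> cA dA; elim: s => [|i s IH].
  by rewrite big_nil mulmx1 subrr mul0r /hnrm dotmxE mul0mx mxE sqrtC0.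
rewrite big_cons /= mulmxA; set B := \big[_/_]_(j <- s) _.
have -> : v - v *m A i *m B = (v - v *m A i) *m B + (v - v *m B).
  by rewrite mulmxBl [RHS]addrC addrA subrK.
rewrite -natr1 mulrDl mul1r; apply: le_trans (hnrmD _ _) _; rewrite addrC lerD //.
by apply: le_trans (dA i); apply: hnrm_contraction; apply: contraction_prod.
Qed.

Lemma mxtrace_idempotent (P : 'M[C]_m) : P *m P = P -> \tr P = (\rank P)%:R.
Proof.
move=> PP; rewrite -{1}(mulmx_base P) mxtrace_mulC.
suff -> : row_base P *m col_base P = 1%:M by rewrite mxtrace1.
apply: (row_free_inj (row_base_free P)).
apply: (row_full_inj (col_base_full P)).
have aux r (c : 'M[C]_(m, r)) (w : 'M_(r, m)) : c *m w = P ->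
    c *m (w *m c *m w) = P.
  by move=> cw; rewrite -mulmxA cw mulmxA cw.
by rewrite mul1mx mulmx_base aux // mulmx_base.
Qed.
End OrthoProj.

Section IsotypicProj.
Local Open Scope sesquilinear_scope.
Variables (C : numClosedFieldType) (n m : nat).
Local Notation Sn := [set: {perm 'I_n}]%G.
Variable rG : mx_representation C Sn m.
Hypothesis uG : unitary_repr rG.

Lemma proj_module_commute (N : 'M_m) g : mxmodule rG N ->
  rG g *m proj_ortho N = proj_ortho N *m rG g.
Proof.
move=> modN; apply: proj_ortho_commute; last rewrite uG.
  by rewrite (mxmoduleP modN) ?inE.
by rewrite (mxmoduleP modN) ?inE.
Qed.

Section Shape.
Variable l : seq nat.
Hypothesis nl : sumn l = n.
Local Notation P := (proj_ortho (isotypic_mx rG l)).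

Lemma isotypic_module : mxmodule rG (isotypic_mx rG l).
Proof. by rewrite (eqmx_module _ (isotypic_mxE nl rG)) young_span_module. Qed.

Lemma isotypic_proj_commute A : (forall h, A *m rG h = rG h *m A) ->
  A *m P = P *m A.
Proof.
move=> cA; have stab B : (forall h, B *m rG h = rG h *m B) ->
    (isotypic_mx rG l *m B <= isotypic_mx rG l)%MS.
  move=> cB; rewrite (eqmxMr _ (isotypic_mxE nl rG)) isotypic_mxE //.
  exact: young_span_stable.
apply: proj_ortho_commute; apply: stab => // h.
by rewrite -[h]invgK -uG -!trC_mul cA.
Qed.

(** The projection onto N commutes with the group, hence with the projection
    onto the isotypic component. *)
Lemma isotypic_proj_stable (N : 'M_m) : mxmodule rG N -> (N *m P <= N)%MS.
Proof.
move=> modN; rewrite -{1}(proj_ortho_id (submx_refl N)) -mulmxA.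
rewrite isotypic_proj_commute => [|h]; last by rewrite proj_module_commute.
by rewrite mulmxA proj_ortho_sub.
Qed.
End Shape.

Definition alt_op (X : {set 'I_n}) : 'M[C]_m :=
  \sum_(g : {perm 'I_n} | perm_on X g) (-1) ^+ odd_perm g *: rG g.

(** Joint kernel of the antisymmetrizers over r + 1 points.  For the action on
    the legs T of a tensor power it contains the powers of the tensors whose
    rank across T is at most r. *)
Definition alt_ker r : 'M[C]_m :=
  (\bigcap_(X : {set 'I_n} | #|X| == r.+1) kermx (alt_op X))%MS.

Lemma alt_op_fixed (X : {set 'I_n}) (i j : 'I_n) p (W : 'M_(p, m)) :
  i \in X -> j \in X -> i != j -> W *m rG (tperm i j) = W -> W *m alt_op X = 0.
Proof.
move=> iX jX ij fW; set A := alt_op X.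
have tA : rG (tperm i j) *m A = - A.
  rewrite mulmx_sumr -sumrN [RHS](reindex_inj (mulgI (tperm i j))) /=.
  have tX : perm_on X (tperm i j).
    apply/subsetP => x; rewrite inE; case: tpermP => [-> //|-> //|_ _].
    by rewrite eqxx.
  apply: eq_big => [g|g _].
    apply/idP/idP => gX; first exact: perm_onM.
    by rewrite -[g](mulKg (tperm i j)) tpermV perm_onM.
  by rewrite repr_permM odd_permM odd_tperm ij /= signrN scaleNr opprK -scalemxAr.
suff: W *m A = - (W *m A).
  by move/eqP; rewrite -addr_eq0 -mulr2n -scaler_nat scaler_eq0 pnatr_eq0 => /eqP.
by rewrite -{1}fW -mulmxA tA mulmxN.
Qed.

Lemma alt_kerP r p (W : 'M_(p, m)) :
  reflect (forall X : {set 'I_n}, #|X| = r.+1 -> W *m alt_op X = 0)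
          (W <= alt_ker r)%MS.
Proof.
apply: (iffP sub_bigcapmxP) => H X.
  by move=> rX; apply/sub_kermxP/H/eqP.
by move/eqP=> rX; apply/sub_kermxP/H.
Qed.

(** Conjugation by h permutes the antisymmetrizers over r + 1 points; the lemma
    serves for B in the group itself, in a larger group that normalizes its
    action, and in its commutant (h = 1). *)
Lemma alt_ker_stable r (B : 'M_m) h :
  (forall g, B *m rG g = rG (h * g * h^-1)%g *m B) ->
  (alt_ker r *m B <= alt_ker r)%MS.
Proof.
move=> BJ; apply/alt_kerP => X rX.
have /alt_kerP/(_ (h @^-1: X)) : (alt_ker r <= alt_ker r)%MS by [].
rewrite card_preimset ?rX; last exact: perm_inj.
move=> /(_ erefl) K0; rewrite -mulmxA.
rewrite (_ : B *m _ = alt_op (h @^-1: X) *m B) ?mulmxA ?K0 ?mul0mx //.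
rewrite mulmx_sumr mulmx_suml [RHS](reindex_inj (conjg_inj h^-1%g)) /=.
apply: eq_big => [g|g _].
  apply/subsetP/subsetP => gX x; rewrite !inE => gx.
    apply: gX; rewrite inE; apply: contra_neq gx => ghx.
    by rewrite -[in LHS](permK h x) permJ ghx permK.
  have := gX (h^-1%g x); rewrite !inE permJ permKV (inj_eq perm_inj).
  exact.
by rewrite -scalemxAr BJ scalemxAl odd_permJ conjgE invgK mulgA.
Qed.

Lemma alt_ker_module r : mxmodule rG (alt_ker r).
Proof.
apply/mxmoduleP => h _; apply: (@alt_ker_stable _ _ h) => g.
by rewrite -!repr_permM mulgKV.
Qed.

Lemma col_op_alt l (X : {set 'I_n}) :
  X \subset [set i : 'I_n | reshape_offset l i == 0%N] ->
  col_op rG l *m alt_op X = #|[set g : {perm 'I_n} | perm_on X g]|%:R *: col_op rG l.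
Proof.
move=> /subsetP X0; rewrite mulmx_sumr scaler_nat -sumr_const.
apply: eq_big => [g|g gX]; rewrite ?inE //.
rewrite -scalemxAr col_opMr ?scalerA -?expr2 ?sqrr_sign ?scale1r //.
apply/col_stabP => i; have [iX|iX] := boolP (i \in X); last by rewrite (out_perm gX).
have := X0 _ iX; have := X0 (g i); rewrite (perm_closed _ gX) iX !inE.
by move=> /(_ isT)/eqP-> /eqP->.
Qed.

Lemma card_first_col l : sumn l = n -> 0%N \notin l ->
  (size l <= #|[set i : 'I_n | reshape_offset l i == 0%N]|)%N.
Proof.
move=> nl l0; have box (r : 'I_(size l)) :
    exists i : 'I_n, (reshape_index l i == r) && (reshape_offset l i == 0%N).
  have [|i ri ci] := tableau_box nl (r := r) (c := 0).
    by rewrite lt0n; apply: contraNneq l0 => <-; rewrite mem_nth.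
  by exists i; rewrite ri ci !eqxx.
pose f r := xchoose (box r).
have fP r : (reshape_index l (f r) == r) && (reshape_offset l (f r) == 0%N).
  exact: (xchooseP (box r)).
have injf : injective f.
  move=> r s frs; apply: val_inj => /=.
  have /andP[/eqP<- _] := fP r; have /andP[/eqP<- _] := fP s; by rewrite frs.
rewrite -[X in (X <= _)%N]card_ord -(card_image injf).
apply: subset_leq_card; apply/subsetP => i /imageP[r _ ->].
by rewrite inE; case/andP: (fP r).
Qed.

(** If the shape had more than r rows, its first column would contain a set X
    of r + 1 boxes, whose antisymmetrizer is absorbed by C up to a positive
    factor: it could not annihilate the nonzero vector w h R C given by
    young_span_neq0. *)
Lemma isotypic_alt_ker l r (w : 'rV_m) : sumn l = n -> 0%N \notin l ->
  (w <= isotypic_mx rG l)%MS -> (w <= alt_ker r)%MS -> w != 0 -> (size l <= r)%N.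
Proof.
move=> nl l0; rewrite isotypic_mxE // => wI wN w0; rewrite leqNgt; apply/negP => lr.
have [h] := young_span_neq0 uG nl wI w0; apply/negP; rewrite negbK.
pose E := enum [set i : 'I_n | reshape_offset l i == 0%N].
have rE : (r < size E)%N by rewrite -cardE (leq_trans lr) ?card_first_col.
pose X : {set 'I_n} := [set i in take r.+1 E].
have rX : #|X| = r.+1.
  by rewrite cardsE (card_uniqP _) ?take_uniq ?enum_uniq // size_takel.
have X0 : X \subset [set i : 'I_n | reshape_offset l i == 0%N].
  by apply/subsetP => i; rewrite inE => /mem_take; rewrite mem_enum.
have := col_op_alt X0; set k : C := _%:R => colX.
have /alt_kerP/(_ _ rX) : (w *m rG h *m young_op rG l <= alt_ker r)%MS.
  by rewrite mxmodule_young ?mxmodule_trans ?alt_ker_module ?inE.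
rewrite /young_op -!mulmxA colX -!scalemxAr => /eqP; rewrite scaler_eq0 pnatr_eq0.
case/orP => //; rewrite cards_eq0 => /eqP/setP/(_ 1%g).
by rewrite !inE perm_on1.
Qed.

End IsotypicProj.

(** * Orthogonality of two-row components *)

Section OrthogonalShapes.
Local Open Scope sesquilinear_scope.
Variables (C : numClosedFieldType) (n m : nat).
Local Notation Sn := [set: {perm 'I_n}]%G.
Variable rG : mx_representation C Sn m.
Hypothesis uG : unitary_repr rG.

Lemma isotypic_proj_ortho0 l mu : sumn l = n -> sumn mu = n ->
  (forall h, row_op rG l *m rG h *m col_op rG mu = 0) ->
  proj_ortho (isotypic_mx rG l) *m proj_ortho (isotypic_mx rG mu) = 0.
Proof.
move=> nl nmu RC0.
have YY h : young_op rG l *m rG h *m young_op rG mu = 0.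
  rewrite {1}/young_op -!mulmxA mulmxA mul_col_op0 // => q.
  rewrite /young_op !mulmxA mul_row_op0 // => p.
  by rewrite -[_ *m rG q *m _]mulmxA -repr_permM -[_ *m rG _ *m rG p]mulmxA -repr_permM.
have cap0 (w : 'rV_m) : (w <= isotypic_mx rG l)%MS ->
    (w <= isotypic_mx rG mu)%MS -> w = 0.
  rewrite !isotypic_mxE // => /sub_sumsmxP[u wE] wmu; apply/eqP/negPn/negP => w0.
  have [h] := young_span_neq0 uG nmu wmu w0; rewrite wE !mulmx_suml big1 ?eqxx // => g _.
  have Z : young_op rG l *m rG g *m rG h *m young_op rG mu = 0.
    by rewrite -[_ *m rG g *m _]mulmxA -repr_permM YY.
  by rewrite -(mulmxA (u g)) -(mulmxA (u g)) Z mulmx0.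
apply/row_matrixP => i; rewrite row0; apply: cap0; last first.
  by rewrite row_mul proj_ortho_sub.
apply: submx_trans (isotypic_proj_stable uG nmu (isotypic_module rG nl)).
by rewrite row_mul submxMr // (submx_trans (row_sub _ _)) // proj_orthoE.
Qed.

(** The 2 j' boxes that land in the first j' columns of the second shape cannot
    be spread over the rows of the first one without a collision: its second
    row has j < j' boxes, and so more than j' of them share the first row. *)
Lemma two_row_collision j j' (h : {perm 'I_n}) : (j < j')%N -> (j' <= n - j')%N ->
  exists i i' : 'I_n, [/\ i != i',
    reshape_index [:: n - j; j]%N i = reshape_index [:: n - j; j]%N i' &
    reshape_offset [:: n - j'; j']%N (h i) = reshape_offset [:: n - j'; j']%N (h i')].
Proof.
move=> jj' j'n; set l := [:: (n - j)%N; j]; set mu := [:: (n - j')%N; j'].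
have nl : sumn l = n by rewrite /=; lia.
have nmu : sumn mu = n by rewrite /=; lia.
pose A := [set i : 'I_n | (reshape_offset mu (h i) < j')%N].
pose B := [set i : 'I_n | reshape_index l i == 0%N].
have cA : #|A| = (j' + j')%N.
  transitivity #|[set i : 'I_n | (reshape_offset mu i < j')%N]|.
    rewrite -(card_preimset [set i : 'I_n | (reshape_offset mu i < j')%N] (@perm_inj _ h)).
    by apply: eq_card => i; rewrite !inE.
  have /= c0 := card_row_box nmu 0 j'; have /= c1 := card_row_box nmu 1 j'.
  rewrite -(cardsID [set i : 'I_n | reshape_index mu i == 0%N]).
  rewrite (minn_idPr j'n) minnn in c0 c1; congr (_ + _)%N.
    by rewrite -[RHS]c0; apply: eq_card => i; rewrite !inE andbC.
  rewrite -[RHS]c1; apply: eq_card => i; rewrite !inE; congr (_ && _).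
  by have := tableau_row_lt nmu i; case: (reshape_index _ _) => [|[|]].
have cB : #|~: B| = j.
  have := card_row_box nl 1 j; rewrite /= minnn => <-; apply: eq_card => i; rewrite !inE.
  have := tableau_row_lt nl i; have := tableau_col_lt nl i.
  by case: (reshape_index l i) => [|[|]] //= ->.
have cAB : (j' < #|A :&: B|)%N.
  have : (#|A| <= #|A :&: B| + #|~: B|)%N.
    by rewrite -(cardsID B A) leq_add2l subset_leq_card // setDE subsetIr.
  by rewrite cA cB; lia.
have : ~~ [forall i in A :&: B, forall i' in A :&: B,
    (reshape_offset mu (h i) == reshape_offset mu (h i')) ==> (i == i')].
  apply: contraL cAB => /'forall_in_'forall_in_implyP inj; rewrite -leqNgt.
  rewrite -[X in (_ <= X)%N](size_iota 0) -(size_image (fun i => reshape_offset mu (h i))).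
  apply: uniq_leq_size.
    rewrite map_inj_in_uniq ?enum_uniq // => i i'; rewrite !mem_enum => iA iA' ii'.
    by apply/eqP; apply: inj => //; apply/eqP.
  move=> c cI; case: (elimT (@imageP _ _ (fun i : 'I_n => reshape_offset mu (h i)) _ c) cI) => i.
  by rewrite !inE => /andP[ci _] ->; rewrite mem_iota.
rewrite negb_forall_in => /exists_inP[i /setIP[_ iB]].
rewrite negb_forall_in => /exists_inP[i' /setIP[_ iB']].
rewrite negb_imply => /andP[/eqP cii' ii']; exists i, i'; split => //.
by move: iB iB'; rewrite !inE => /eqP-> /eqP->.
Qed.

Lemma two_row_proj_ortho0 j j' : (j <= n - j)%N -> (j' <= n - j')%N -> j != j' ->
  proj_ortho (isotypic_mx rG [:: n - j; j]%N) *m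
  proj_ortho (isotypic_mx rG [:: n - j'; j']%N) = 0.
Proof.
have main a b : (a < b)%N -> (b <= n - b)%N ->
  proj_ortho (isotypic_mx rG [:: n - a; a]%N) *m
  proj_ortho (isotypic_mx rG [:: n - b; b]%N) = 0.
  move=> ab bn; apply: isotypic_proj_ortho0; rewrite /=; try lia.
  move=> h; have [i [i' [ii' rii' cii']]] := two_row_collision h ab bn.
  exact: row_col_collision ii' rii' cii'.
move=> jn j'n; rewrite neq_ltn => /orP[/main-> //|/main j'j].
apply: trmx_inj; apply: (map_mx_inj (f := Num.conj)).
by rewrite -/(_^t*) trC_mul !proj_ortho_trC j'j // trmx0 map_mx0.
Qed.

Lemma sum_proj (T : eqType) (s : seq T) (A : T -> 'M[C]_m) : uniq s ->
  (forall x, A x *m A x = A x) -> (forall x, (A x)^t* = A x) ->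
  {in s &, forall x y, x != y -> A x *m A y = 0} ->
  let P := \sum_(x <- s) A x in P *m P = P /\ P^t* = P.
Proof.
move=> us AA Ah A0 /=; split; last first.
  by rewrite linear_sum /= map_mx_sum; apply: eq_bigr => x _; rewrite Ah.
rewrite mulmx_suml; apply: eq_big_seq => x xs.
rewrite mulmx_sumr (bigD1_seq x) //= AA big_seq_cond big1 ?addr0 // => y.
by case/andP=> ys; rewrite eq_sym => xy; apply: A0.
Qed.

(** The Young symmetrizer of one row is the sum over the whole group. *)
Lemma fixed_isotypic p (W : 'M_(p, m)) : (0 < n)%N -> (forall s, W *m rG s = W) ->
  (W <= isotypic_mx rG [:: n])%MS.
Proof.
move=> n0 fW; have nl : sumn [:: n] = n by rewrite /= addn0.
rewrite isotypic_mxE //.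
have -> : W = (#|row_stab n [:: n]|%:R^-1 : C) *: (W *m young_op rG [:: n] *m rG 1%g).
  rewrite repr_mx1 mulmx1 /young_op mulmxA.
  have -> : col_op rG [:: n] = 1%:M.
    rewrite /col_op (big_pred1 1%g) ?odd_perm1 ?scale1r ?repr_mx1 // => q.
    apply/idP/eqP => [qc|->]; last exact: (group1 (col_stab_group n [:: n])).
    apply: (row_col_stab1 (l := [:: n])) => //; apply/row_stabP => i.
    by have := tableau_row_lt nl i; have := tableau_row_lt nl (q i); rewrite /=; lia.
  rewrite mulmx1 /row_op mulmx_sumr (eq_bigr (fun _ => W)) // sumr_const -scaler_nat scalerA.
  rewrite mulVf ?scale1r // pnatr_eq0 -lt0n; apply/card_gt0P; exists 1%g.
  exact: (group1 (row_stab_group n [:: n])).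
by rewrite scalemx_sub // young_sub_span.
Qed.
End OrthogonalShapes.

(** * The symmetric group acting on some of the legs *)

Section Legs.
Local Open Scope sesquilinear_scope.
Variables (C : numClosedFieldType) (k : nat) (d : 'I_k -> nat) (n : nat).
Implicit Types (T : {set 'I_k}) (s t g h : {perm 'I_n}) (x : pidx n d).
Local Notation L := (@leg_perm_mx C k d n).
Local Notation rho := (@leg_repr C k d n).

Lemma leg_perm_mxE T s a b :
  L T s a b = (leg_perm T s (enum_val a) == enum_val b)%:R.
Proof.
rewrite !mxE eqxx /= eq_sym; congr (nat_of_bool _)%:R.
by apply/eqP/eqP => [<-|->]; rewrite ?enum_rankK ?enum_valK.
Qed.

Lemma leg_perm_eqV T s x y : (leg_perm T s x == y) = (leg_perm T s^-1 y == x).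
Proof.
by apply/eqP/eqP => <-; rewrite -leg_permM ?mulgV ?mulVg leg_perm1.
Qed.

Lemma leg_repr_unitary T : unitary_repr (rho T).
Proof.
move=> s; apply/matrixP => a b; transitivity ((L T s b a)^*); first by rewrite !mxE.
by rewrite leg_perm_mxE rmorph_nat leg_perm_eqV -leg_perm_mxE.
Qed.

Lemma row_leg_perm p (W : 'M[C]_(p, #|pidx n d|)) T s i x :
  (W *m L T s) i (enum_rank x) = W i (enum_rank (leg_perm T s^-1 x)).
Proof.
rewrite mxE (bigD1 (enum_rank (leg_perm T s^-1 x))) //= big1 ?addr0.
  by rewrite leg_perm_mxE leg_perm_eqV !enum_rankK eqxx mulr1.
move=> a ax; rewrite leg_perm_mxE leg_perm_eqV enum_rankK.
case: eqP => [E|_]; last by rewrite mulr0.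
by rewrite E enum_valK eqxx in ax.
Qed.

Lemma delta_leg_perm x T s :
  delta_mx 0 (enum_rank x) *m L T s = delta_mx 0 (enum_rank (leg_perm T s x)) :> 'rV[C]_ _.
Proof. by rewrite -rowE rowK enum_rankK. Qed.

Lemma leg_perm_mx_eq T1 s1 T2 s2 T3 s3 T4 s4 :
  (forall x, leg_perm T2 s2 (leg_perm T1 s1 x) = leg_perm T4 s4 (leg_perm T3 s3 x)) ->
  L T1 s1 *m L T2 s2 = L T3 s3 *m L T4 s4.
Proof.
move=> E; apply/row_matrixP => a; rewrite !row_mul !rowK.
by rewrite !delta_leg_perm E.
Qed.

Lemma leg_disjoint T T' s t : [disjoint T & T'] ->
  L T s *m L T' t = L T' t *m L T s.
Proof.
move=> dis; apply: leg_perm_mx_eq => x; apply/ffunP => j; apply/ffunP => i.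
rewrite !ffunE; have := disjoint_setI0 dis; move/setP/(_ i); rewrite !inE.
by case: (i \in T); case: (i \in T').
Qed.

Lemma leg_subset T T' g h : T \subset T' ->
  L T' h *m L T g = L T (h * g * h^-1)%g *m L T' h.
Proof.
move=> /subsetP TT'; apply: leg_perm_mx_eq => x; apply/ffunP => j; apply/ffunP => i.
rewrite !ffunE; have := TT' i; case: (i \in T) => [->//|_].
  by rewrite !invMg !invgK !permM permKV.
by [].
Qed.

Lemma leg_split T s : L T s *m L (~: T) s = L [set: 'I_k] s.
Proof.
rewrite -[RHS]mulmx1 -(repr_mx1 (rho [set: 'I_k])); apply: leg_perm_mx_eq => x.
apply/ffunP => j; apply/ffunP => i; rewrite leg_perm1 !ffunE !inE.
by case: (i \in T).
Qed.

Definition is_sym p (W : 'M[C]_(p, #|pidx n d|)) :=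
  forall s, W *m L [set: 'I_k] s = W.

Lemma is_symP p (W : 'M[C]_(p, #|pidx n d|)) :
  reflect (is_sym W) (W <= rfix_mx (rho [set: 'I_k]) [set: {perm 'I_n}])%MS.
Proof.
apply: (iffP idP) => [/rfix_mxP H s|H]; first by apply: H; rewrite inE.
by apply/rfix_mxP => s _; apply: H.
Qed.

(** The actions on T and on its complement compose to the action on all legs,
    which is trivial on symmetric vectors. *)
Lemma sym_leg_compl p (W : 'M[C]_(p, #|pidx n d|)) T s : is_sym W ->
  W *m L T s = W *m L (~: T) s^-1%g.
Proof.
move=> symW; rewrite -{1}(symW s^-1%g) -(leg_split (~: T)) setCK.
rewrite -!mulmxA -(@repr_permM _ _ _ (rho T)) mulVg.
by rewrite (@repr_mx1 _ _ _ _ (rho T)) mulmx1.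
Qed.

(** An antisymmetrizer is invariant under inversion of the group elements. *)
Lemma sym_alt_ker p (W : 'M[C]_(p, #|pidx n d|)) T r : is_sym W ->
  (W <= alt_ker (rho T) r)%MS -> (W <= alt_ker (rho (~: T)) r)%MS.
Proof.
move=> symW /alt_kerP WT; apply/alt_kerP => X rX; rewrite -[RHS](WT X rX).
rewrite !mulmx_sumr [LHS](reindex_inj invg_inj) /=; apply: eq_big => [s|s _].
  apply/subsetP/subsetP => sX i; rewrite inE => si; apply: sX; rewrite inE;
  by apply: contra_neq si => {1}<-; rewrite ?permK ?permKV.
by rewrite odd_permV -!scalemxAr sym_leg_compl // setCK invgK.
Qed.

Local Notation P T l := (proj_ortho (isotypic_mx (rho T) l)).

Lemma sym_proj p (W : 'M[C]_(p, #|pidx n d|)) T l : sumn l = n -> is_sym W ->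
  is_sym (W *m P T l).
Proof.
move=> nl symW s; rewrite -mulmxA.
suff -> : P T l *m L [set: 'I_k] s = L [set: 'I_k] s *m P T l by rewrite mulmxA symW.
have uT := leg_repr_unitary T.
rewrite -(leg_split T) mulmxA -(proj_module_commute uT s (isotypic_module _ nl)).
rewrite -[LHS]mulmxA -[RHS]mulmxA (isotypic_proj_commute uT nl) // => h.
by apply: leg_disjoint; rewrite -setI_eq0 setIC setICr.
Qed.

(** In both cases the joint kernel for A is a submodule for the action on T:
    that action normalizes the action on A if A is contained in T, and commutes
    with it if A and T are disjoint. *)
Lemma proj_alt_ker p (W : 'M[C]_(p, #|pidx n d|)) T (A : {set 'I_k}) l r : sumn l = n ->
  (A \subset T) || [disjoint A & T] ->
  (W <= alt_ker (rho A) r)%MS -> (W *m P T l <= alt_ker (rho A) r)%MS.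
Proof.
move=> nl AT WA; apply: submx_trans (submxMr _ WA) _.
apply: isotypic_proj_stable; rewrite ?nl //; first exact: leg_repr_unitary.
apply/mxmoduleP => h _; case/orP: AT => AT.
  by apply: (@alt_ker_stable _ _ _ _ _ _ h) => g; apply: leg_subset.
apply: (@alt_ker_stable _ _ _ _ _ _ 1%g) => g; rewrite mul1g invg1 mulg1 /=.
by rewrite leg_disjoint // disjoint_sym.
Qed.
End Legs.

(** * Tensor powers of the unit tensor *)

Section UnitTensor.
Local Open Scope sesquilinear_scope.
Variables (R : realType) (k : nat) (S : {set 'I_k}) (n : nat).
Local Notation C := R[i]%C.
Local Notation d := (unit_dim S).
Local Notation L := (@leg_perm_mx C k d n).
Local Notation rho := (@leg_repr C k d n).
Local Notation psi := (tensor_power n (@unit_tensor R k S)).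
Implicit Types (T : {set 'I_k}) (s : {perm 'I_n}) (X Y : {set 'I_n}).

Lemma bit_subproof (i : 'I_k) (b : bool) : ((if i \in S then b : nat else 0) < d i)%N.
Proof. by rewrite /unit_dim; case: ifP => // _; case: b. Qed.

Definition bit (i : 'I_k) (b : bool) : 'I_(d i) := Ordinal (bit_subproof i b).

Lemma leg_trivial (i : 'I_k) (c c' : 'I_(d i)) : i \notin S -> c = c'.
Proof.
move=> iS; apply: val_inj; case: c c' => [c cd] [c' cd'] /=.
by move: cd cd'; rewrite /unit_dim (negPf iS) !ltnS !leqn0 => /eqP-> /eqP->.
Qed.

(** Sets of positions in 'I_n stand for words of n bits: the legs of S inside T
    carry the word X and those outside T carry Y. *)
Definition bits T X Y : pidx n d :=
  [ffun j => [ffun i => bit i (if i \in T then j \in X else j \in Y)]].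

Definition diag X : pidx n d := bits finset.set0 X X.

Lemma bits_diag T X : bits T X X = diag X.
Proof. by apply/ffunP => j; apply/ffunP => i; rewrite !ffunE; case: ifP; case: ifP. Qed.

Lemma leg_perm_bits T s X Y : leg_perm T s (bits T X Y) = bits T (s @: X) Y.
Proof.
apply/ffunP => j; apply/ffunP => i; rewrite !ffunE.
case: (boolP (i \in T)) => // iT; congr bit.
by rewrite -[in RHS](permKV s j) mem_imset //; apply: perm_inj.
Qed.

Lemma bits_inj T X Y X' Y' : S :&: T != finset.set0 -> S :&: ~: T != finset.set0 ->
  bits T X Y = bits T X' Y' -> X = X' /\ Y = Y'.
Proof.
move=> /set0Pn[i /setIP[iS iT]] /set0Pn[i' /setIP[iS' iT']] E.
rewrite inE in iT'; split; apply/setP => j.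
  have /(congr1 val) := congr1 (fun x : pidx n d => x j i) E.
  by rewrite !ffunE iT /= iS; do 2 case: (_ \in _).
have /(congr1 val) := congr1 (fun x : pidx n d => x j i') E.
by rewrite !ffunE (negPf iT') /= iS'; do 2 case: (_ \in _).
Qed.

Lemma tensor_powerE (a : 'I_#|pidx n d|) :
  psi 0 a = \sum_(X : {set 'I_n}) (enum_val a == diag X)%:R.
Proof.
rewrite mxE; set x := enum_val a.
have unitE (j : 'I_n) : unit_tensor R S (x j) =
   \prod_i (x j i == bit i true)%:R + \prod_i (x j i == bit i false)%:R :> C.
  rewrite ffunE !big_ord_recl big_ord0 addr0 addrC.
  by congr (_ + _); apply: eq_bigr => i _; congr (nat_of_bool _)%:R; case: (i \in S).
rewrite (eq_bigr _ (fun j _ => unitE j)) bigA_distr; apply: eq_big => // X _.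
transitivity (\prod_(j < n) \prod_(i < k) ((x j i == bit i (j \in X))%:R : C)).
  by apply: eq_bigr => j _; case: ifP.
rewrite pair_big /=; case: eqP => [->|xX].
  by rewrite big1 // => -[j i] _ /=; rewrite !ffunE; case: ifP; rewrite eqxx.
have /existsP[[j i] nji] : [exists ji : 'I_n * 'I_k, x ji.1 ji.2 != bit ji.2 (ji.1 \in X)].
  apply/existsP; apply: contra_notP xX => nex; apply/ffunP => j; apply/ffunP => i.
  apply/eqP/negPn/negP => ne; apply: nex; exists (j, i) => /=.
  by apply: contraNneq ne => ->; rewrite !ffunE if_same.
by rewrite (bigD1 (j, i)) //= (negPf nji) mul0r.
Qed.

Lemma tensor_power_sum : psi = \sum_(X : {set 'I_n}) delta_mx 0 (enum_rank (diag X)).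
Proof.
apply/rowP => a; rewrite tensor_powerE summxE; apply: eq_bigr => X _.
by rewrite mxE eqxx /= -{2}(enum_valK a) (inj_eq enum_rank_inj).
Qed.

Lemma imset_permK s X : s^-1%g @: (s @: X) = X.
Proof.
by rewrite -imset_comp -[RHS]imset_id; apply: eq_imset => i /=; rewrite permK.
Qed.

Lemma imset_permKV s X : s @: (s^-1%g @: X) = X.
Proof. by rewrite -{1}[s]invgK imset_permK. Qed.

Lemma tensor_power_sym : is_sym psi.
Proof.
move=> s; rewrite tensor_power_sum mulmx_suml [RHS](reindex_onto (fun X => s @: X) (fun X => s^-1%g @: X)).
  apply: eq_big => [X|X _].
    by rewrite imset_permK eqxx.
  rewrite delta_leg_perm; congr (delta_mx _ (enum_rank _)).
  by rewrite -(bits_diag [set: _]) leg_perm_bits; apply/ffunP => j; apply/ffunP => i; rewrite !ffunE inE; case: ifP.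
by move=> X _; rewrite imset_permKV.
Qed.

Definition splits T := (S :&: T != finset.set0) && (S :&: ~: T != finset.set0).

Lemma leg_perm_nonsplit T s : ~~ splits T ->
  (forall x : pidx n d, leg_perm T s x = x) \/
  (forall x : pidx n d, leg_perm T s x = leg_perm [set: 'I_k] s x).
Proof.
rewrite negb_and !negbK => /orP[] /eqP/setP E; [left|right] => x;
  apply/ffunP => j; apply/ffunP => i; rewrite !ffunE ?inE; case: ifP => //;
  move=> iT; apply: leg_trivial; have := E i; rewrite !inE iT ?andbT => -> //.
Qed.

Lemma tensor_power_nonsplit T s : ~~ splits T -> psi *m L T s = psi.
Proof.
move=> nsp; have [E|E] := leg_perm_nonsplit s nsp.
  rewrite -[RHS]mulmx1 -(repr_mx1 (rho T)); congr (_ *m _).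
  by apply/row_matrixP => a; rewrite !rowK E leg_perm1.
rewrite -[RHS](tensor_power_sym s); congr (_ *m _).
by apply/row_matrixP => a; rewrite !rowK E.
Qed.

Definition max_rows T := if splits T then 2%N else 1%N.

(** If T splits S, psi is a sum of basis vectors diag Z; of any three positions
    two carry the same bit of Z, and their transposition fixes diag Z.  If T
    does not split S, every transposition fixes psi. *)
Lemma tensor_power_alt T : (psi <= alt_ker (rho T) (max_rows T))%MS.
Proof.
apply/alt_kerP => X; rewrite /max_rows; case: ifP => [_ X3|/negbT nsp X2].
  rewrite tensor_power_sum mulmx_suml big1 // => Z _.
  have [i [j [iX jX ij Zij]]] : exists i j, [/\ i \in X, j \in X, i != j & (i \in Z) = (j \in Z)].
    have [c2|] := ltnP 1 #|X :&: Z|.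
      have [i [j [/setIP[iX iZ] /setIP[jX jZ] ij]]] := card_gt1P c2.
      by exists i, j; rewrite iZ jZ.
    have := cardsID Z X; rewrite X3 => cX c1.
    have /card_gt1P[i [j [/setDP[iX iZ] /setDP[jX jZ] ij]]] : (1 < #|X :\: Z|)%N.
      rewrite -(leq_add2l #|X :&: Z|) cX; lia.
    by exists i, j; rewrite (negPf iZ) (negPf jZ).
  apply: (alt_op_fixed iX jX ij).
  rewrite delta_leg_perm -(bits_diag T) leg_perm_bits (_ : tperm i j @: Z = Z) //.
  apply/setP => x; rewrite -{1}(tpermK i j x) mem_imset; last exact: perm_inj.
  by case: tpermP => // ->.
have /card_gt1P[i [j [iX jX ij]]] : (1 < #|X|)%N by rewrite X2.
by apply: (alt_op_fixed iX jX ij); apply: tensor_power_nonsplit.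
Qed.

End UnitTensor.

(** * Vectors annihilated by two-row symmetrizers *)

Section Polytabloid.
Variables (C : numFieldType) (n j : nat).
Hypothesis jn : (j <= n - j)%N.
Local Notation l := [:: n - j; j]%N.
Implicit Types (A B X : {set 'I_n}) (p q h : {perm 'I_n}).

Let nl : sumn l = n. Proof. by rewrite /=; lia. Qed.

Definition low_row : {set 'I_n} := [set i : 'I_n | reshape_index l i == 1%N].
Local Notation B0 := low_row.

Lemma low_rowN i : i \notin B0 -> reshape_index l i = 0%N.
Proof.
by rewrite inE; have := tableau_row_lt nl i; case: (reshape_index l i) => [|[|]].
Qed.

Lemma card_low_row : #|B0| = j.
Proof.
have := card_row_box nl 1 j; rewrite /= minnn => <-; apply: eq_card => i; rewrite !inE.
by have := tableau_col_lt nl i; case: eqP => //= ->.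
Qed.

Lemma imset_permM p q X : q @: (p @: X) = (p * q)%g @: X.
Proof. by rewrite -imset_comp; apply: eq_imset => i /=; rewrite permM. Qed.

Lemma row_stab_low p : p \in row_stab n l -> p @: B0 = B0.
Proof.
move=> /row_stabP pr; apply/eqP; rewrite eqEcard card_imset ?leqnn ?andbT; last exact: perm_inj.
by apply/subsetP => _ /imsetP[i iB ->]; move: iB; rewrite !inE pr.
Qed.

Lemma mem_tperm_imset (a b : 'I_n) X x : (x \in tperm a b @: X) = (tperm a b x \in X).
Proof. by rewrite -{1}(tpermK a b x) mem_imset //; apply: perm_inj. Qed.

(** A column-preserving permutation swaps the two boxes of some columns and
    fixes everything else; its sign counts the swapped columns, which are those
    whose lower box leaves the lower row.  Induction unswaps one of them. *)
Lemma col_stab_sign q : q \in col_stab n l ->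
  (-1) ^+ odd_perm q = (-1) ^+ #|(q @: B0) :\: B0| :> C.
Proof.
move et : #|_ :\: _| => t; elim: t q et => [|t IH] q et qc.
  suff -> : q = 1%g by rewrite odd_perm1.
  have sub : q @: B0 \subset B0 by rewrite -setD_eq0 -cards_eq0 et.
  have eqB : q @: B0 = B0.
    by apply/eqP; rewrite eqEcard sub card_imset ?leqnn //; apply: perm_inj.
  apply: (row_col_stab1 (l := l)) => //; apply/row_stabP => i.
  have : (q i \in B0) = (i \in B0) by rewrite -{1}eqB mem_imset //; apply: perm_inj.
  have [iB|iB] := boolP (i \in B0).
    by move: iB; rewrite !inE => /eqP-> /eqP->.
  by move/negbT => /low_rowN->; rewrite low_rowN.
have /card_gt0P[a /setDP[/imsetP[b bB ab] aB]] : (0 < #|(q @: B0) :\: B0|)%N by rewrite et.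
have colE : reshape_offset l a = reshape_offset l b by rewrite ab (elimT (col_stabP l q) qc).
have nab : a != b by apply: contraNneq aB => ->.
have bq : b \notin q @: B0.
  apply/imsetP => -[c cB bc]; case/eqP: nab; rewrite ab [in RHS]bc; congr (q _).
  apply: (tableau_inj (l := l)); first by move: bB cB; rewrite !inE => /eqP-> /eqP->.
  by rewrite bc (elimT (col_stabP l q) qc).
have tc : tperm a b \in col_stab n l by apply: col_stab_tperm.
have := IH (q * tperm a b)%g; rewrite odd_permM odd_tperm nab addbT.
rewrite (groupMl _ (qc : q \in col_stab_group n l)) => IHq.
have eqD : ((q * tperm a b)%g @: B0) :\: B0 = ((q @: B0) :\: B0) :\ a.
  apply/setP => x; rewrite -imset_permM !inE mem_tperm_imset.
  case: tpermP => [->|->|xa xb].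
  - by rewrite (negPf bq) eqxx /= andbF.
  - by move: bB; rewrite inE => ->; rewrite andbF.
  - by move/eqP: xa => ->.
rewrite exprS -IHq // ?signrN ?mulN1r ?opprK //.
rewrite eqD; have := cardsD1 a ((q @: B0) :\: B0); rewrite et inE aB.
by rewrite ab mem_imset ?bB; [case | apply: perm_inj].
Qed.

Variable u : {set 'I_n} -> C.
Hypothesis Du : forall A, #|A|.+1 = j -> \sum_(a | a \notin A) u (a |: A) = 0.

Let F B := \sum_(p in row_stab n l) u (p @: B).

Lemma row_avg_inv p B : p \in row_stab n l -> F (p @: B) = F B.
Proof.
move=> pr; rewrite /F [RHS](reindex_inj (mulgI p)) /=; apply: eq_big => q.
  by rewrite (groupMl _ (pr : p \in row_stab_group n l)).
by rewrite imset_permM.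
Qed.

Lemma row_avg_down A : #|A|.+1 = j -> \sum_(a | a \notin A) F (a |: A) = 0.
Proof.
move=> Aj; rewrite exchange_big big1 // => p _ /=.
rewrite -[RHS](Du (A := p @: A)); last by rewrite card_imset //; apply: perm_inj.
rewrite [RHS](reindex_inj (@perm_inj _ p)) /=; apply: eq_big => a.
  by rewrite mem_imset //; apply: perm_inj.
by rewrite imsetU1.
Qed.

(** The average F of u over the row stabilizer depends only on the number t of
    points outside the lower row, and Du = 0 at B minus one such point relates
    the values for t and t + 1 by the factor - (t + 1) / (n - j - t). *)
Lemma row_avg_sign t : exists2 e : C, 0 < e &
  forall B, #|B| = j -> #|B :\: B0| = t -> F B = (-1) ^+ t * e * F B0.
Proof.
elim: t => [|t [e e0 IH]].
  exists 1 => // B Bj BB; rewrite mulr1 mul1r; congr F.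
  apply/eqP; rewrite eqEcard card_low_row Bj leqnn andbT.
  by rewrite -setD_eq0 -cards_eq0 BB.
have [tj|jt] := ltnP t j; last first.
  exists 1 => // B Bj BB; have := subset_leq_card (subsetDl B B0).
  by rewrite BB Bj => /(leq_trans (_ : (j < t.+1)%N)); rewrite ltnn ltnS => /(_ jt).
have D0 : (0 : C) < (n - j - t)%:R by rewrite ltr0n; lia.
exists (t.+1%:R / (n - j - t)%:R * e); first by rewrite mulr_gt0 // divr_gt0 // ltr0n.
move=> B Bj BB.
have /card_gt0P[a /setDP[aB aB0]] : (0 < #|B :\: B0|)%N by rewrite BB.
pose A := B :\ a.
have Aj : #|A|.+1 = j by have := cardsD1 a B; rewrite aB Bj add1n => ->.
have BA : B = a |: A by rewrite setD1K.
have At : #|A :\: B0| = t.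
  have := cardsD1 a (B :\: B0); rewrite BB in_setD aB aB0 /= add1n => -[->].
  by apply: eq_card => x; rewrite !inE andbCA.
have cAB : #|A :&: B0| = (j - t.+1)%N.
  by have := cardsID B0 A; rewrite At; lia.
have := row_avg_down Aj; rewrite (bigID (mem B0)) /=.
rewrite (eq_bigr (fun _ => (-1) ^+ t * e * F B0)); last first.
  move=> x /andP[xA xB]; apply: IH; first by rewrite cardsU1 xA.
  rewrite -At; apply: eq_card => y; rewrite in_setD [in RHS]in_setD in_setU1.
  by case: (y =P x) => [->|_]; rewrite ?xB.
rewrite sumr_const (eq_bigr (fun _ => F B)); last first.
  move=> x /andP[xA xB].
  have -> : x |: A = tperm a x @: B.
    have aA : a \notin A by rewrite in_setD1 eqxx.
    apply/setP => y; rewrite mem_tperm_imset BA !in_setU1.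
    case: tpermP => [->|->|/eqP/negPf-> /eqP/negPf-> //]; last by rewrite !eqxx.
    by rewrite (negPf aA) (negPf xA) eq_sym.
  rewrite row_avg_inv // row_stab_tperm // (low_rowN aB0) (low_rowN xB) //.
rewrite sumr_const.
have -> : #|[pred x | x \notin A & x \in B0]| = t.+1.
  have := cardsID A B0; rewrite card_low_row setIC cAB => E.
  rewrite -[LHS]/#|[pred x | (x \notin A) && (x \in B0)]|.
  have -> : #|[pred x | (x \notin A) && (x \in B0)]| = #|B0 :\: A|.
    by apply: eq_card => x; rewrite !inE.
  lia.
have -> : #|[pred x | x \notin A & x \notin B0]| = (n - j - t)%N.
  have -> : #|[pred x | (x \notin A) && (x \notin B0)]| = #|~: (A :|: B0)|.
    by apply: eq_card => x; rewrite !inE negb_or.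
  by rewrite cardsCs setCK card_ord cardsU card_low_row cAB; lia.
move=> E.
have D0' : (n - j - t)%:R != 0 :> C by rewrite gt_eqF.
have {}E : F B * (n - j - t)%:R = - ((-1) ^+ t * e * F B0 * t.+1%:R).
  by apply/eqP; rewrite -addr_eq0 addrC !mulr_natr E.
apply: (mulIf D0'); rewrite E exprS.
by field.
Qed.

(** By row_avg_sign and col_stab_sign all terms of the signed column sum have
    the sign of the value at the lower row, so nothing cancels. *)
Lemma row_col_sum_eq0 :
  \sum_(q in col_stab n l) \sum_(p in row_stab n l)
     (-1) ^+ odd_perm q * u (p @: (q @: B0)) = 0 -> u B0 = 0.
Proof.
move=> sum0.
have ex t : exists e : C, 0 < e /\
    forall B, #|B| = j -> #|B :\: B0| = t -> F B = (-1) ^+ t * e * F B0.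
  by have [e] := row_avg_sign t; exists e.
have [e /all_and2[e0 eP]] := boolp.choice ex.
have FB0 : F B0 = 0.
  apply/eqP; move: sum0.
  rewrite (eq_bigr (fun q => e #|q @: B0 :\: B0| * F B0)); last first.
    move=> q qc; have cq : #|q @: B0| = j by rewrite card_imset ?card_low_row //; apply: perm_inj.
    rewrite -mulr_sumr -/(F _) (eP _ (q @: B0) cq erefl).
    by rewrite col_stab_sign // !mulrA -exprMn mulrNN mul1r expr1n mul1r.
  rewrite -mulr_suml => /eqP; rewrite mulf_eq0 => /orP[|//].
  rewrite gt_eqF // (bigD1 1%g) /=; last exact: (group1 (col_stab_group n l)).
  by rewrite ltr_pwDl // sumr_ge0 // => q _; apply: ltW.
have : #|row_stab n l|%:R * u B0 = 0.
  rewrite mulr_natl -sumr_const -[RHS]FB0; apply: eq_bigr => p pr.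
  by rewrite row_stab_low.
move/eqP; rewrite mulf_eq0 pnatr_eq0 cards_eq0 => /orP[/eqP/setP/(_ 1%g)|/eqP//].
by rewrite in_set0 (group1 (row_stab_group n l)).
Qed.
End Polytabloid.

Section Shadow.
Variables (C : numFieldType) (n : nat).
Implicit Types (A B X : {set 'I_n}) (p q h : {perm 'I_n}) (c : {set 'I_n} -> C).

Lemma perm_between A B : #|A| = #|B| -> exists h : {perm 'I_n}, h @: B = A.
Proof.
move=> AB; pose s (D : {set 'I_n}) := enum D ++ enum (~: D).
have us D : uniq (s D).
  rewrite cat_uniq !enum_uniq andbT /=; apply/hasPn => x.
  by rewrite !mem_enum inE.
have ss D : size (s D) = n by rewrite size_cat -!cardE cardsC card_ord.
have ms D x : x \in s D by rewrite mem_cat !mem_enum inE orbN.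
have ix z : (index z (s B) < n)%N by have := ms B z; rewrite -index_mem ss.
have injf : injective (fun i => nth i (s A) (index i (s B))).
  move=> x y; rewrite (set_nth_default y) ?ss // => /eqP.
  rewrite nth_uniq ?ss // => /eqP E.
  by rewrite -(nth_index x (ms B x)) E nth_index.
exists (perm injf); apply/eqP; rewrite eqEcard card_imset ?AB ?leqnn ?andbT; last exact: perm_inj.
apply/subsetP => _ /imsetP[x xB ->]; rewrite permE.
have ixA : (index x (s B) < size (enum A))%N.
  by rewrite -cardE AB cardE index_cat mem_enum xB index_mem mem_enum.
by rewrite nth_cat ixA -mem_enum mem_nth.
Qed.

Definition young_killed c j := forall h X,
  \sum_(q in col_stab n [:: n - j; j]%N) \sum_(p in row_stab n [:: n - j; j]%N)
     (-1) ^+ odd_perm q * c (h @: (p @: (q @: X))) = 0.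

(** Sum of c over the sets of size w containing A: the iterated lowering
    operator from sets of size w to sets of size #|A|. *)
Definition shadow c w A := \sum_(X : {set 'I_n} | (#|X| == w) && (A \subset X)) c X.

Lemma shadow_down c w A :
  \sum_(a | a \notin A) shadow c w (a |: A) = (w - #|A|)%:R * shadow c w A.
Proof.
rewrite (exchange_big_dep (fun X : {set 'I_n} => (#|X| == w) && (A \subset X))) /=; last first.
  by move=> a X aA /andP[-> /subUsetP[_ ->]].
rewrite mulr_sumr; apply: eq_bigr => X /andP[/eqP Xw AX].
rewrite sumr_const mulr_natl -Xw -cardsDS //; congr (_ *+ _); apply: eq_card => a.
by rewrite [LHS]unfold_in /= subUset sub1set eqxx AX !inE andbT.
Qed.

Lemma shadow_perm c w p B : shadow (fun X => c (p @: X)) w B = shadow c w (p @: B).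
Proof.
rewrite /shadow [RHS](reindex_onto (fun X : {set 'I_n} => p @: X) (fun X => p^-1%g @: X)).
  apply: eq_bigl => X; rewrite imset_permK eqxx andbT card_imset; last exact: perm_inj.
  congr (_ && _); apply/idP/idP => [|H]; first exact: imsetS.
  by rewrite -(imset_permK p B) -(imset_permK p X) imsetS.
by move=> X _; rewrite imset_permKV.
Qed.

(** Induction on #|A|.  If the shadows on sets of size a vanish, those on sets
    of size a + 1 form a function u with Du = 0 (shadow_down), and
    row_col_sum_eq0 applies at every translate of the lower row. *)
Lemma killed_shadow0 c w w0 : (w <= n - w)%N ->
  (forall j, (w0 < j)%N -> (j <= n - j)%N -> young_killed c j) ->
  (forall A, (#|A| <= w0)%N -> shadow c w A = 0) ->
  forall A, (#|A| <= w)%N -> shadow c w A = 0.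
Proof.
move=> wn kc s0 A; move: {2}(#|A|) (leqnn #|A|) => a; elim: a A => [|a IH] A.
  by rewrite leqn0 => /eqP A0 _; apply: s0; rewrite A0.
rewrite leq_eqVlt => /orP[/eqP Aa|/IH//] aw.
have [Aw0|Aw0] := leqP #|A| w0; first exact: s0.
have An : (#|A| <= n - #|A|)%N by lia.
have kj := kc _ Aw0 An; rewrite Aa in An kj.
have [h hA] : exists h : {perm 'I_n}, h @: low_row n a.+1 = A.
  by apply: perm_between; rewrite (card_low_row An).
rewrite -hA -shadow_perm; apply: (@row_col_sum_eq0 C n a.+1 An (shadow (fun X => c (h @: X)) w)).
  move=> B [Ba]; rewrite shadow_down shadow_perm IH ?mulr0 //;
    by rewrite card_imset ?Ba; [lia | apply: perm_inj].
transitivity (\sum_(X : {set 'I_n} | (#|X| == w) && (low_row n a.+1 \subset X))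
   \sum_(q in col_stab n [:: n - a.+1; a.+1]%N) \sum_(p in row_stab n [:: n - a.+1; a.+1]%N)
     (-1) ^+ odd_perm q * c (h @: (p @: (q @: X)))); last by rewrite big1.
rewrite [RHS]exchange_big /=; apply: eq_bigr => q _.
rewrite [RHS]exchange_big /=; apply: eq_bigr => p _.
by rewrite -mulr_sumr -!shadow_perm.
Qed.

Lemma shadow_full c w A : #|A| = w -> shadow c w A = c A.
Proof.
move=> Aw; rewrite /shadow (big_pred1 A) // => X /=; apply/andP/eqP => [[/eqP Xw AX]|->].
  by apply/esym/eqP; rewrite eqEcard AX Xw Aw leqnn.
by rewrite Aw eqxx.
Qed.

(** The shadow of c on a set of the same size is c itself.  Sets of more than
    n / 2 elements are reduced to their complements. *)
Lemma killed_eq0 c w0 :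
  (forall j, (w0 < j)%N -> (j <= n - j)%N -> young_killed c j) ->
  (forall A w, (#|A| <= w0)%N -> (w <= n)%N ->
     (if (w <= n - w)%N then shadow c w A else shadow (fun X => c (~: X)) (n - w)%N A) = 0) ->
  forall X, c X = 0.
Proof.
move=> kc s0 X; have [w wX] : exists w, #|X| = w by exists #|X|.
have wn : (w <= n)%N by rewrite -wX -[X in (_ <= X)%N]card_ord max_card.
have := fun A Aw => s0 A w Aw wn; case: leqP => ww sw.
  by rewrite -(shadow_full c wX) (killed_shadow0 ww kc sw) ?wX.
have cX : #|~: X| = (n - w)%N by rewrite cardsCs setCK card_ord wX.
rewrite -[X]setCK -(shadow_full (fun X => c (~: X)) cX).
apply: (killed_shadow0 _ _ sw); rewrite ?cX //; first lia.
move=> j j0 jn h Y; rewrite -[RHS](kc j j0 jn h (~: Y)).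
have setCp p (Z : {set 'I_n}) : ~: (p @: Z) = p @: (~: Z).
  apply/setP => x; rewrite -[x](permKV p) inE !mem_imset ?inE //; exact: perm_inj.
by apply: eq_bigr => q _; apply: eq_bigr => p _; rewrite !setCp.
Qed.
End Shadow.

(** * The tensor power outside the balanced components *)

Section BadDimension.
Local Open Scope sesquilinear_scope.
Variables (R : realType) (k : nat) (S : {set 'I_k}) (n : nat).
Local Notation C := R[i]%C.
Local Notation d := (unit_dim S).
Local Notation L := (@leg_perm_mx C k d n).
Local Notation rho := (@leg_repr C k d n).
Local Notation psi := (tensor_power n (@unit_tensor R k S)).
Local Notation N := #|{set 'I_n}|.
Implicit Types (s : {perm 'I_n}) (X Y : {set 'I_n}).

Variable T : {set 'I_k}.
Hypothesis spT : splits S T.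

(** Freezing the bits Y outside T makes w a function of the bits X in T, on
    which pi_T acts by permuting the positions. *)
Definition slice (w : 'rV[C]_#|pidx n d|) Y X : C := w 0 (enum_rank (bits S T X Y)).

Lemma slice_perm w s Y X : slice (w *m L T s) Y X = slice w Y (s^-1%g @: X).
Proof. by rewrite /slice row_leg_perm leg_perm_bits. Qed.

Lemma slice_killed w j Y :
  (forall h, w *m L T h *m young_op (rho T) [:: n - j; j]%N = 0) ->
  young_killed (slice w Y) j.
Proof.
move=> w0 h X; set l := [:: _; _].
transitivity (slice 0 Y X); last by rewrite /slice mxE.
rewrite -(w0 h^-1%g) /young_op mulmxA [col_op _ _]/col_op mulmx_sumr [in RHS]/slice summxE.
rewrite (reindex_inj invg_inj) /=; apply: eq_big => [q|q _].
  by rewrite (groupV (col_stab_group n l)).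
rewrite -scalemxAr [RHS]mxE odd_permV -mulr_sumr; congr (_ * _).
rewrite /row_op mulmx_sumr mulmx_suml summxE (reindex_inj invg_inj) /=.
apply: eq_big => [p|p _]; first by rewrite (groupV (row_stab_group n l)).
by rewrite -[RHS]/(slice _ Y X) !slice_perm invgK.
Qed.

Definition slice_mx (w : 'rV[C]_#|pidx n d|) : 'M[C]_N :=
  \matrix_(a, b) slice w (enum_val a) (enum_val b).

Definition small_sets w0 : {set {set 'I_n}} := [set A : {set 'I_n} | (#|A| <= w0)%N].

Section Shadows.
Variable (w0 : nat).
Local Notation K := (finset.setX (small_sets w0) [set: 'I_n.+1]).

(** The columns are the shadows on sets of at most w0 elements, for each size w
    of the sets; for w above n / 2 the complements are used, as in
    killed_eq0. *)
Definition shadow_mx : 'M[C]_(N, #|K|) :=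
  \matrix_(a, b) let: (A, w) := enum_val b : {set 'I_n} * 'I_n.+1 in
    let X : {set 'I_n} := enum_val a in
    if (w <= n - w)%N then ((#|X| == w) && (A \subset X))%:R
    else ((#|~: X| == (n - w)%N) && (A \subset ~: X))%:R.

Lemma mul_shadow_mx (v : 'rV[C]_N) b :
  (v *m shadow_mx) 0 b =
    let: (A, w) := enum_val b : {set 'I_n} * 'I_n.+1 in let c X := v 0 (enum_rank X) in
    if (w <= n - w)%N then shadow c w A else shadow (fun X => c (~: X)) (n - w)%N A.
Proof.
rewrite mxE; under eq_bigr do rewrite mxE; case: (enum_val b) => A w /=.
have sumE (Q : pred {set 'I_n}) : \sum_(a < N) v 0 a * (Q (enum_val a))%:R =
    \sum_(X | Q X) v 0 (enum_rank X).
  rewrite [RHS]big_mkcond /= [RHS](reindex_onto enum_val enum_rank) /=; last by move=> *; apply: enum_rankK.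
  apply: eq_big => [a|a _]; first by rewrite enum_valK eqxx.
  by rewrite enum_valK; case: (Q _); rewrite ?mulr1 ?mulr0.
case: leqP => _.
  by rewrite (sumE (fun X => (#|X| == w) && (A \subset X))).
rewrite (sumE (fun X => (#|~: X| == (n - w)%N) && (A \subset ~: X))) /shadow.
rewrite [RHS](reindex_inj (inv_inj (@setCK _))) /=; apply: eq_bigr => X _.
by rewrite setCK.
Qed.

(** The shadow map is injective on functions killed by the symmetrizers of all
    two-row shapes with second row longer than w0 (killed_eq0). *)
Lemma rank_slice (B : 'M[C]_N) :
  (forall v : 'rV_N, (v <= B)%MS -> forall j, (w0 < j)%N -> (j <= n - j)%N ->
     young_killed (fun X => v 0 (enum_rank X)) j) ->
  (\rank B <= #|small_sets w0| * n.+1)%N.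
Proof.
move=> kB.
have cap0 : (B :&: kermx shadow_mx)%MS = 0.
  apply/eqP/negPn/negP => /rowV0Pn[v]; rewrite sub_capmx => /andP[vB /sub_kermxP vS] v0.
  case/eqP: v0; apply/rowP => a; rewrite mxE -(enum_valK a).
  apply: (killed_eq0 (c := fun X => v 0 (enum_rank X)) (w0 := w0)).
    exact: kB.
  move=> A w Aw wn.
  have AwK : (A, inord w : 'I_n.+1) \in K by rewrite !inE Aw.
  have /rowP/(_ (enum_rank_in AwK (A, inord w))) := vS.
  by rewrite mul_shadow_mx enum_rankK_in // mxE inordK.
rewrite -(mxrank_mul_ker B shadow_mx) cap0 mxrank0 addn0.
by rewrite (leq_trans (rank_leq_col _)) // cardsX cardsT card_ord.
Qed.
End Shadows.

(** For the orthogonal projection P onto the row space of B, expand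
    0 <= |B - P|^2 = |B|^2 - 2 tr B + rank B in the Hilbert-Schmidt norm. *)
Lemma trace_le_rank m (B : 'M[C]_m) (t : C) : t \is Num.real ->
  \tr B = t -> \tr (B *m B^t*) <= t -> t <= (\rank B)%:R.
Proof.
move=> treal trB nB; set P := proj_ortho B.
have BP : B *m P = B by rewrite proj_ortho_id.
have PB : P *m B^t* = B^t* by rewrite -{1}[P]proj_ortho_trC -trC_mul BP.
have rP : \tr P = (\rank B)%:R.
  by rewrite mxtrace_idempotent ?proj_ortho_proj // proj_orthoE.
have trBs : \tr (B^t*) = t.
  by rewrite -map_trmx mxtrace_tr -[RHS](CrealP treal) -trB /mxtrace rmorph_sum; apply: eq_bigr => i _; rewrite mxE.
have pos : 0 <= \tr ((B - P) *m (B - P)^t*).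
  by rewrite sumr_ge0 // => i _; rewrite mxE sumr_ge0 // => j _; rewrite !mxE mul_conjC_ge0.
move: pos; rewrite trCB proj_ortho_trC mulmxBl !mulmxBr BP PB proj_ortho_proj.
rewrite !raddfB /= trB trBs rP => pos.
rewrite -subr_ge0; apply: le_trans pos _; rewrite -subr_ge0.
set x := \tr _ in nB *; rewrite (_ : _ - _ = t - x) ?subr_ge0 //.
by ring.
Qed.

Lemma slice_tensor_power X Y : slice psi Y X = (X == Y)%:R.
Proof.
rewrite /slice tensor_powerE enum_rankK.
case/andP: spT => s1 s2; case: eqP => [->|XY].
  rewrite (bigD1 Y) //= (bits_diag S T) eqxx big1 ?addr0 // => Z ZY.
  case: eqP => //; rewrite -(bits_diag S T Z) -(bits_diag S T Y) => /bits_inj[] // YZ.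
  by rewrite YZ eqxx in ZY.
rewrite big1 // => Z _; case: eqP => //; rewrite -(bits_diag S T Z) => /bits_inj[] // XZ YZ.
by case: XY; rewrite XZ YZ.
Qed.

Lemma sqr_norm_tensor_power : dotmx psi psi = (2 ^ n)%:R.
Proof.
rewrite {2}tensor_power_sum dotmxE linear_sum /= map_mx_sum mulmx_sumr summxE.
have <- : #|[set: {set 'I_n}]| = (2 ^ n)%N.
  by rewrite -powersetT card_powerset cardsT card_ord.
rewrite -sumr_const; apply: eq_big => [Z|Z _]; first by rewrite inE.
rewrite mxE (bigD1 (enum_rank (diag S Z))) //= big1 => [|a aZ].
  rewrite !mxE !eqxx conjC1 mulr1 addr0.
  by have := slice_tensor_power Z Z; rewrite /slice (bits_diag S T) eqxx mxE => ->.
by rewrite !mxE (negPf aZ) conjC0 mulr0.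
Qed.


Lemma young_killed_sum (I : finType) (a : I -> C) (c : I -> {set 'I_n} -> C) j :
  (forall i, young_killed (c i) j) -> young_killed (fun X => \sum_i a i * c i X) j.
Proof.
move=> kc h X; transitivity (\sum_i a i * 0); last by rewrite big1 // => i _; rewrite mulr0.
under [RHS]eq_bigr => i _ do rewrite -(kc i h X) mulr_sumr.
rewrite [RHS]exchange_big /=; apply: eq_bigr => q _.
under [RHS]eq_bigr do rewrite mulr_sumr.
rewrite [RHS]exchange_big /=; apply: eq_bigr => p _.
by rewrite mulr_sumr; apply: eq_bigr => i _; rewrite mulrCA.
Qed.

Local Notation P j := (proj_ortho (isotypic_mx (rho T) [:: n - j; j]%N)).

Lemma orthogonal_killed (w : 'rV[C]_#|pidx n d|) j : (j <= n - j)%N -> w *m P j = 0 ->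
  forall h, w *m L T h *m young_op (rho T) [:: n - j; j]%N = 0.
Proof.
move=> jn wP h; have nl : sumn [:: n - j; j]%N = n by rewrite /=; lia.
have Pcomm x : rho T x *m P j = P j *m rho T x.
  by apply: proj_module_commute; [apply: leg_repr_unitary | apply: isotypic_module].
have in_iso : (w *m L T h *m young_op (rho T) [:: n - j; j]%N
     <= isotypic_mx (rho T) [:: n - j; j]%N)%MS.
  rewrite isotypic_mxE // -[X in (X <= _)%MS]mulmx1 -(repr_mx1 (rho T)).
  exact: young_sub_span.
rewrite -(proj_ortho_id in_iso) -(mulmxA (w *m _)) (young_op_hom _ Pcomm) mulmxA.
by rewrite -[w *m L T h *m _]mulmxA Pcomm (mulmxA w) wP !mul0mx.
Qed.

Lemma sum_slice_le w :
  \tr (slice_mx w *m (slice_mx w)^t*) <= dotmx w w.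
Proof.
have -> : \tr (slice_mx w *m (slice_mx w)^t*) =
    \sum_(p : {set 'I_n} * {set 'I_n}) `|w 0 (enum_rank (bits S T p.2 p.1))| ^+ 2.
  rewrite -(pair_bigA _ (fun Y X => `|w 0 (enum_rank (bits S T X Y))| ^+ 2)) /=.
  rewrite /mxtrace (reindex_onto enum_rank enum_val) /=; last by move=> *; apply: enum_valK.
  apply: eq_big => [Y|Y _]; first by rewrite enum_rankK eqxx.
  rewrite mxE (reindex_onto enum_rank enum_val) /=; last by move=> *; apply: enum_valK.
  apply: eq_big => [X|X _]; first by rewrite enum_rankK eqxx.
  by rewrite !mxE !enum_rankK normCK.
rewrite dotmxE mxE.
have injz : injective (fun p : {set 'I_n} * {set 'I_n} => enum_rank (bits S T p.2 p.1)).
  move=> [Y X] [Y' X'] /enum_rank_inj /=; case/andP: spT => s1 s2.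
  by move/(bits_inj s1 s2) => [-> ->].
under [leRHS]eq_bigr do rewrite !mxE -normCK.
rewrite -(big_imset (fun a => `|w 0 a| ^+ 2)) /=; last by move=> p q _ _; apply: injz.
rewrite [leRHS](bigID (mem [set enum_rank (bits S T p.2 p.1) | p : {set 'I_n} * {set 'I_n}])) /=.
by rewrite lerDl sumr_ge0 // => a _; rewrite exprn_ge0.
Qed.

(** Let w be psi minus its good part and b the matrix of its slices.  Because w
    is an orthogonal projection of psi, |w|^2 = <w, psi> = tr b, while
    |b|^2 <= |w|^2; so |w|^2 is at most the rank of b (trace_le_rank).  The
    rows of b are killed by the good symmetrizers, hence rank_slice bounds
    this rank. *)
Theorem good_part_norm (G : seq nat) w0 : uniq G ->
  {in G, forall j, (j <= n - j)%N} ->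
  (forall j, (w0 < j)%N -> (j <= n - j)%N -> j \in G) ->
  let Pg : 'M[C]_#|pidx n d| := \sum_(j <- G) P j in
  dotmx (psi - psi *m Pg) (psi - psi *m Pg) <= (#|small_sets w0| * n.+1)%:R.
Proof.
move=> uniqG GE Gall /=; set Pg := \sum_(j <- G) _.
have uT : unitary_repr (rho T) by apply: leg_repr_unitary.
have PP0 : {in G &, forall i j, i != j -> P i *m P j = 0}.
  by move=> i j iG jG ij; apply: two_row_proj_ortho0; rewrite ?GE.
have [PgPg Pgh] : Pg *m Pg = Pg /\ Pg^t* = Pg.
  apply: sum_proj => // j; first exact: proj_ortho_proj.
  exact: proj_ortho_trC.
set w := psi - psi *m Pg.
have wE : w = psi *m (1%:M - Pg) by rewrite mulmxBr mulmx1.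
have wPg j : j \in G -> w *m P j = 0.
  move=> jG; rewrite wE -mulmxA mulmxBl mul1mx.
  suff -> : Pg *m P j = P j by rewrite subrr mulmx0.
  rewrite mulmx_suml (bigD1_seq j) //= proj_ortho_proj big_seq_cond big1 ?addr0 // => i.
  by case/andP=> iG ij; apply: PP0.
have wpsi : dotmx w w = \sum_(Z : {set 'I_n}) w 0 (enum_rank (diag S Z)).
  transitivity ((w *m psi^t*) 0 0).
    rewrite dotmxE {2}wE trC_mul trCB Pgh trmx1 map_mx1 mulmxA wE.
    have QQ : (1%:M - Pg) *m (1%:M - Pg) = 1%:M - Pg.
      by rewrite mulmxBr mulmx1 mulmxBl mul1mx PgPg subrr subr0.
    by rewrite -[psi *m _ *m (1%:M - Pg)]mulmxA QQ.
  rewrite {1}tensor_power_sum linear_sum /= map_mx_sum mulmx_sumr summxE.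
  apply: eq_bigr => Z _; rewrite mxE (bigD1 (enum_rank (diag S Z))) //= big1 => [|a aZ].
    by rewrite !mxE !eqxx conjC1 mulr1 addr0.
  by rewrite !mxE (negPf aZ) conjC0 mulr0.
have trb : \tr (slice_mx w) = dotmx w w.
  rewrite wpsi /mxtrace (reindex_onto enum_rank enum_val) /=; last by move=> *; apply: enum_valK.
  apply: eq_big => [X|X _]; first by rewrite enum_rankK eqxx.
  by rewrite mxE enum_rankK /slice bits_diag.
apply: le_trans (trace_le_rank _ trb (sum_slice_le w)) _.
  by rewrite ger0_real ?dnorm_ge0.
rewrite ler_nat; apply: rank_slice => v /submxP[u ->] j w0j jn.
have -> : (fun X => (u *m slice_mx w) 0 (enum_rank X)) =
    (fun X => \sum_a u 0 a * slice w (enum_val a) X).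
  by apply: boolp.funext => X; rewrite mxE; apply: eq_bigr => a _; rewrite mxE enum_rankK.
apply: young_killed_sum => a; apply: slice_killed.
by apply: orthogonal_killed => //; apply/wPg/Gall.
Qed.

End BadDimension.

(** * Counting and entropy estimates *)

Section Counting.
Variable R : realType.

(** Each set A with at most w0 elements contributes t ^ #|A| >= t ^ w0 to the
    binomial expansion. *)
Lemma card_small_sets n w0 (t : R) : 0 < t -> t <= 1 ->
  #|small_sets n w0|%:R * t ^+ w0 <= (1 + t) ^+ n.
Proof.
move=> t0 t1.
have -> : (1 + t) ^+ n = \sum_(A : {set 'I_n}) t ^+ #|A|.
  have -> : (1 + t) ^+ n = \prod_(i < n) (t + 1) by rewrite prodr_const card_ord addrC.
  rewrite bigA_distr; apply: eq_big => // A _.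
  by rewrite -big_mkcond /= prodr_const.
rewrite (bigID (mem (small_sets n w0))) /= mulr_natl -sumr_const.
rewrite -[leLHS]addr0 lerD ?sumr_ge0 // => [|A _]; last by rewrite exprn_ge0 ?ltW.
apply: ler_sum => A; rewrite inE => Aw.
by apply: ler_wiXn2l => //; apply: ltW.
Qed.

Lemma bernoulli (x : R) m : 0 <= x -> 1 + m%:R * x <= (1 + x) ^+ m.
Proof.
move=> x0; elim: m => [|m IH]; first by rewrite mul0r addr0.
rewrite exprS; apply: le_trans (ler_wpM2l _ IH); last by rewrite addr_ge0.
have : 0 <= m%:R * x * x by rewrite !mulr_ge0.
by rewrite -natr1; lra.
Qed.

Lemma bernoulliN (x : R) m : 0 <= x -> x <= 1 -> 1 - m%:R * x <= (1 - x) ^+ m.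
Proof.
move=> x0 x1; elim: m => [|m IH]; first by rewrite mul0r subr0.
rewrite exprS; apply: le_trans (ler_wpM2l _ IH); last by rewrite subr_ge0.
have : 0 <= m%:R * x * x by rewrite !mulr_ge0.
by rewrite -natr1; lra.
Qed.

(** With t = N / (N + 1) one has (1 + t)^2 / 4 t = 1 + x for
    x = 1 / (4 N (N + 1)), and (1 + x)^N (1 - N x) <= 1; this is still enough to
    make (1 + x)^N t at most 4 N / (4 N + 3) < 1. *)
Lemma block_ratio N (t : R) : (0 < N)%N -> t = N%:R / N.+1%:R ->
  (1 + t) ^+ (2 * N) <= 4 ^+ N * t ^+ N.-1 * (4 * N%:R / (4 * N%:R + 3)).
Proof.
case: N => // N _ tE /=; set M : R := N.+1%:R.
have M0 : 0 < M by rewrite ltr0n.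
have tM : t = M / (M + 1) by rewrite tE /M natr1.
have t0 : 0 < t by rewrite tM divr_gt0 // addr_gt0.
pose x := (4 * M * (M + 1))^-1.
have x0 : 0 <= x by rewrite invr_ge0 !mulr_ge0 // ltW // addr_gt0.
have x1 : x <= 1.
  by rewrite invf_le1 ?mulr_gt0 ?addr_gt0 //; have : 1 <= M by [rewrite ler1n]; nra.
have tx : (1 + t) ^+ 2 = 4 * t * (1 + x).
  rewrite tM /x; field; lra.
have le1 : (1 + x) ^+ N.+1 * (1 - M * x) <= 1.
  apply: le_trans (_ : (1 + x) ^+ N.+1 * (1 - x) ^+ N.+1 <= _).
    by rewrite ler_wpM2l ?bernoulliN // exprn_ge0 // addr_ge0.
  rewrite -exprMn exprn_ile1 //; nra.
have Mx : 1 - M * x = (4 * M + 3) / (4 * (M + 1)) by rewrite /x; field; lra.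
rewrite exprM tx !exprMn -!mulrA ler_pM2l ?exprn_gt0 // exprSr -mulrA ler_pM2l ?exprn_gt0 //.
have c0 : 0 < 1 - M * x by rewrite Mx divr_gt0 //; lra.
rewrite -(ler_pM2r c0) -mulrA.
apply: le_trans (_ : t * 1 <= _); first by rewrite ler_pM2l.
by rewrite Mx tM le_eqVlt; apply/orP; left; apply/eqP; field; lra.
Qed.

(** A subset of 2 N m points with at most (N - 1) m elements has density bounded
    away from 1/2; such sets are exponentially rare in m by block_ratio, which
    absorbs the linear factor 2 N m + 1. *)
Lemma small_sets_rare N D : (0 < N)%N -> exists2 m, (0 < m)%N &
  (#|small_sets (2 * N * m) (N.-1 * m)| * (2 * N * m).+1 * D <= 2 ^ (2 * N * m))%N.
Proof.
move=> N0; pose t : R := N%:R / N.+1%:R; pose s : R := 3 / (4 * N%:R).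
have NR : 0 < N%:R :> R by rewrite ltr0n.
have s0 : 0 < s by rewrite divr_gt0 // mulr_gt0.
have t0 : 0 < t by rewrite divr_gt0 // ltr0n.
have t1 : t <= 1 by rewrite ler_pdivrMr ?ltr0n // mul1r ler_nat.
(* D (n + 1) / (m' s)^2 <= 5 N D / (m' s^2), as n + 1 <= 5 N m'. *)
pose B : R := 5 * N%:R * D%:R / s ^+ 2.
pose m' := (Num.truncn B).+1; exists (m' + m')%N => //.
have Bm : B <= m'%:R by apply: ltW; apply: Num.Theory.truncnS_gt.
set m := (m' + m')%N; set n := (2 * N * m)%N; set w0 := (N.-1 * m)%N.
rewrite -(ler_nat R) !natrM natrX.
have qE : 4 * N%:R / (4 * N%:R + 3) = (1 + s)^-1 :> R.
  by rewrite /s; field; lra.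
have card_le : #|small_sets n w0|%:R <= 2 ^+ n * (1 + s)^-1 ^+ m.
  have tw : 0 < t ^+ w0 by rewrite exprn_gt0.
  rewrite -(ler_pM2r tw); apply: le_trans (card_small_sets _ _ t0 t1) _.
  have := block_ratio N0 (erefl t); rewrite qE => br.
  have -> : (1 + t) ^+ n = ((1 + t) ^+ (2 * N)) ^+ m by rewrite -exprM.
  have -> : 2 ^+ n * (1 + s)^-1 ^+ m * t ^+ w0 = (4 ^+ N * t ^+ N.-1 * (1 + s)^-1) ^+ m.
    rewrite !exprMn -!exprM /n /w0 -mulnA exprM (_ : 2 ^+ 2 = 4 :> R); last by ring.
    by rewrite mulrAC.
  by rewrite lerXn2r // ?nnegrE ?exprn_ge0 ?mulr_ge0 ?invr_ge0 ?addr_ge0 ?exprn_ge0 ?ltW.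
have pow_le : (1 + s)^-1 ^+ m <= (m'%:R * s)^-1 ^+ 2.
  rewrite /m addnn -mul2n mulnC exprM.
  have a0 : 0 <= (1 + s)^-1 ^+ m' by rewrite exprn_ge0 // invr_ge0 addr_ge0 // ltW.
  have b0 : 0 <= (m'%:R * s)^-1 by rewrite invr_ge0 mulr_ge0 // ltW.
  rewrite lerXn2r ?nnegrE // exprVn.
  have p1 : 0 < (1 + s) ^+ m' by rewrite exprn_gt0 // addr_gt0.
  have p2 : 0 < m'%:R * s by rewrite mulr_gt0 // ltr0n.
  rewrite lef_pV2 ?posrE //.
  by apply: le_trans (bernoulli _ (ltW s0)); rewrite lerDr.
have D0 : 0 <= D%:R :> R by [].
have n1 : 0 <= n.+1%:R :> R by [].
have m'0 : 0 < m'%:R :> R by rewrite ltr0n.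
apply: le_trans (_ : (2 ^+ n * (m'%:R * s)^-1 ^+ 2) * n.+1%:R * D%:R <= _).
  rewrite ler_wpM2r // ler_wpM2r //; apply: le_trans card_le _.
  by rewrite ler_wpM2l // exprn_ge0.
rewrite -(mulrA _ n.+1%:R) -(mulrA (2 ^+ n)) -[leRHS]mulr1 ler_wpM2l ?exprn_ge0 //.
have p2 : 0 < (m'%:R * s) ^+ 2 by rewrite exprn_gt0 // mulr_gt0.
rewrite (exprVn (m'%:R * s)) (ler_pdivrMl _ _ p2) mulr1 (exprMn 2 m'%:R s).
have nm : n.+1%:R <= 5 * N%:R * m'%:R :> R.
  by rewrite -!natrM ler_nat /n /m; nia.
apply: le_trans (ler_wpM2r D0 nm) _.
have -> : 5 * N%:R * m'%:R * D%:R = B * s ^+ 2 * m'%:R by rewrite /B; field; rewrite gt_eqF.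
have := ler_wpM2r (ltW m'0) (ler_wpM2r (exprn_ge0 2 (ltW s0)) Bm).
by move=> H; apply: le_trans H _; rewrite le_eqVlt; apply/orP; left; apply/eqP; ring.
Qed.

End Counting.


Section Entropy.
Variable R : realType.

Lemma ln2_gt0 : 0 < ln (2 : R).
Proof. by rewrite ln_gt0 // ltr1n. Qed.

Lemma ln_split2 (p : R) : 0 < p -> ln p = ln (2 * p) - ln 2.
Proof. by move=> p0; rewrite lnM ?posrE // addrC addKr. Qed.

(** Both entropy estimates come from ln x <= x - 1, applied to 1 / 2 p and
    to 2 p. *)
Lemma entropy_term_le (p : R) : 0 < p -> - (p * ln p) <= p * ln 2 + 2^-1 - p.
Proof.
move=> p0; have p2 : 0 < 2 * p by rewrite mulr_gt0.
have : - ln (2 * p) <= (2 * p)^-1 - 1.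
  rewrite -lnV ?posrE // -{1}(subrK 1 (2 * p)^-1) addrC.
  apply: le_ln1Dx; rewrite ltrBrDr addrC subrr invr_gt0 //.
move/(ler_wpM2l (ltW p0)); rewrite (ln_split2 p0).
have -> : p * ((2 * p)^-1 - 1) = 2^-1 - p by field; lra.
by lra.
Qed.

Lemma entropy_term_ge (p : R) : 0 < p -> p * ln 2 - p * (2 * p - 1) <= - (p * ln p).
Proof.
move=> p0; have p2 : 0 < 2 * p by rewrite mulr_gt0.
have : ln (2 * p) <= 2 * p - 1.
  rewrite -{1}(subrK 1 (2 * p)) addrC.
  by apply: le_ln1Dx; rewrite ltrBrDr addrC subrr.
move/(ler_wpM2l (ltW p0)); rewrite (ln_split2 p0).
by lra.
Qed.

Lemma entropy_one_row n : (0 < n)%N -> entropy R n [:: n] = 0.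
Proof.
by move=> n0; rewrite /entropy big_seq1 divff ?pnatr_eq0 -?lt0n // ln1 mul0r mulr0 oppr0.
Qed.

Section TwoRows.
Variables (n a b : nat).
Hypotheses (a0 : (0 < a)%N) (b0 : (0 < b)%N) (abn : (a + b)%N = n).
Let p : R := a%:R / n%:R.
Let q : R := b%:R / n%:R.

Let n0 : 0 < n%:R :> R. Proof. by rewrite ltr0n -abn addn_gt0 a0. Qed.
Let p0 : 0 < p. Proof. by rewrite divr_gt0 // ltr0n. Qed.
Let q0 : 0 < q. Proof. by rewrite divr_gt0 // ltr0n. Qed.
Let pq1 : p + q = 1.
Proof. by rewrite /p /q -mulrDl -natrD abn divff // gt_eqF. Qed.

Lemma entropy_two_rowsE :
  entropy R n [:: a; b] = (- (p * ln p) - q * ln q) / ln 2.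
Proof.
rewrite /entropy big_cons big_seq1 -/p -/q !mulrA -mulrDl -mulNr opprD.
by [].
Qed.

Lemma entropy_two_rows_le1 : entropy R n [:: a; b] <= 1.
Proof.
rewrite entropy_two_rowsE ler_pdivrMr ?ln2_gt0 // mul1r.
have := entropy_term_le p0; have := entropy_term_le q0.
have -> : q = 1 - p by rewrite -pq1 addrC addKr.
by lra.
Qed.

Lemma entropy_two_rows_ge (e : R) : 0 <= 1 - 2 * q -> 1 - 2 * q <= e ->
  1 - e ^+ 2 / ln 2 <= entropy R n [:: a; b].
Proof.
move=> e0 ee; have l0 := ln2_gt0.
have -> : 1 - e ^+ 2 / ln 2 = (ln 2 - e ^+ 2) / ln 2.
  by rewrite mulrBl divff // gt_eqF.
rewrite entropy_two_rowsE ler_pM2r ?invr_gt0 //.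
have := entropy_term_ge p0; have := entropy_term_ge q0.
have pE : p = 1 - q by rewrite -pq1 addrK.
have : (1 - 2 * q) ^+ 2 <= e ^+ 2 by rewrite lerXn2r // nnegrE // (le_trans e0).
rewrite pE; nra.
Qed.
End TwoRows.

Lemma entropy_few_rows n (l : seq nat) : (0 < n)%N -> is_partition_of n l ->
  ((size l <= 1)%N -> entropy R n l = 0) /\ ((size l <= 2)%N -> entropy R n l <= 1).
Proof.
move=> n0 /and3P[_ l0 /eqP nl]; case: l l0 nl => [|a [|b [|]]] //= l0 nl.
- by rewrite -nl in n0.
- rewrite addn0 in nl; rewrite nl entropy_one_row //; split=> // _; exact: ler01.
- split=> // _; move: l0; rewrite !inE !negb_or ![0%N == _]eq_sym -!lt0n => /andP[a0 b0].
  by apply: entropy_two_rows_le1; rewrite -?nl ?addn0.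
Qed.

End Entropy.

(** * The value of the functional on unit tensors *)

Section Choice.
Variables (C : numClosedFieldType) (m : nat) (B T : eqType).

(** Expand the first factor of the product and use induction for the others. *)
Lemma choose_factors (s : seq B) (G : B -> seq T) (M : B -> T -> 'M[C]_m) (v : 'rV_m) :
  uniq s -> v *m \big[mulmx/1%:M]_(b <- s) (\sum_(l <- G b) M b l) != 0 ->
  (forall b, G b != [::]) ->
  exists2 l : B -> T, (forall b, l b \in G b) &
    v *m \big[mulmx/1%:M]_(b <- s) M b (l b) != 0.
Proof.
move=> us nz G0; elim: s us v nz => [|b s IH] /= us v.
  rewrite !big_nil => v0; have hd b : exists x, x \in G b.
    by case: (G b) (G0 b) => // x t _; exists x; rewrite mem_head.
  by have [f fG] := boolp.choice hd; exists f; rewrite ?big_nil.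
case/andP: us => bs us; rewrite big_cons mulmxA mulmx_sumr mulmx_suml => nz.
have [x xG nzx] : exists2 x, x \in G b &
    v *m M b x *m \big[mulmx/1%:M]_(j <- s) (\sum_(l <- G j) M j l) != 0.
  apply/hasP; apply: contraNT nz => /hasPn no; apply/eqP; rewrite [LHS]big_seq big1 // => x xG.
  by have := no x xG; rewrite negbK => /eqP.
have [l lG nzl] := IH us _ nzx.
exists (fun c => if c == b then x else l c) => [c|]; first by case: eqP => [->|].
rewrite big_cons eqxx mulmxA (eq_big_seq (fun c => M c (l c))) // => c cs.
by case: eqP => // cb; rewrite -cb cs in bs.
Qed.
End Choice.

Section Functional.
Local Open Scope sesquilinear_scope.
Variables (R : realType) (k : nat) (S : {set 'I_k}).
Local Notation C := R[i]%C.
Local Notation d := (unit_dim S).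
Local Notation psi n := (tensor_power n (@unit_tensor R k S)).
Local Notation rho n := (@leg_repr C k d n).
Local Notation bip := (bipartition k).

Lemma sideP (b : bip) : [/\ side b != finset.set0, side b != [set: 'I_k] &
  val b = [set side b; ~: side b]%SET].
Proof.
by have /and3P[h1 h2 /eqP h3] := xchooseP (existsP (valP b)).
Qed.

Definition bip_splits (b : bip) := splits S (side b).

(** The invariant carried along the product of projectors: the vector is
    symmetric and, for every bipartition c of the support, annihilated by the
    antisymmetrizers of max_rows + 1 copies on a side of c.  Laminarity gives a
    side A of c contained in a side of b; it is contained in, or disjoint from,
    the side on which the projector of b acts. *)
Lemma proj_bip_inv n (theta : {ffun bip -> R}) (v : 'rV[C]_#|pidx n d|) b l :
  lam_distr theta -> b \in bip_supp theta -> is_partition_of n l ->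
  is_sym v -> (forall c, c \in bip_supp theta ->
     (v <= alt_ker (rho n (side c)) (max_rows S (side c)))%MS) ->
  let v' := v *m proj_bip R d n b l in
  [/\ is_sym v', forall c, c \in bip_supp theta ->
     (v' <= alt_ker (rho n (side c)) (max_rows S (side c)))%MS &
     v' != 0 -> (size l <= max_rows S (side b))%N].
Proof.
move=> [_ _ lam] bs /and3P[_ l0 /eqP nl] symv altv /=.
have -> : v *m proj_bip R d n b l = v *m proj_ortho (isotypic_mx (rho n (side b)) l).
  have vs : v *m proj_sym R d n = v by apply: proj_ortho_id; apply/is_symP.
  by rewrite /proj_bip mulmxA vs.
have sym' := sym_proj (side b) nl symv.
have alt' c : c \in bip_supp theta ->
    (v *m proj_ortho (isotypic_mx (rho n (side b)) l)
       <= alt_ker (rho n (side c)) (max_rows S (side c)))%MS.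
  move=> cs; have /exists_inP[A Ac /exists_inP[B Bb AB]] := lam _ _ cs bs.
  have [_ _ cE] := sideP c; have [_ _ bE] := sideP b.
  have AT : (A \subset side b) || [disjoint A & side b].
    move: Bb; rewrite bE !inE => /orP[/eqP BE|/eqP BE]; rewrite -?BE ?AB //.
    by rewrite disjoints_subset -BE AB orbT.
  move: Ac; rewrite cE !inE => /orP[] /eqP AE.
    by rewrite -AE; apply: proj_alt_ker; rewrite // AE; apply: altv.
  rewrite -[side c]setCK -AE; apply: sym_alt_ker sym' _.
  apply: proj_alt_ker; rewrite //.
  by have := sym_alt_ker symv (altv _ cs); rewrite AE setCK.
split=> // nz.
have uT : unitary_repr (rho n (side b)) by apply: leg_repr_unitary.
exact: (isotypic_alt_ker uT nl l0 (proj_ortho_sub _ _) (alt' b bs) nz).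
Qed.

Lemma tuple_few_rows n (theta : {ffun bip -> R}) (l : bip -> seq nat) :
  lam_distr theta -> {in bip_supp theta, forall b, is_partition_of n (l b)} ->
  psi n *m \big[mulmx/1%:M]_(b in bip_supp theta) proj_bip R d n b (l b) != 0 ->
  {in bip_supp theta, forall b, (size (l b) <= max_rows S (side b))%N}.
Proof.
move=> lam part; rewrite -big_filter; set s0 := [seq i <- _ | _].
have ms0 b : (b \in s0) = (b \in bip_supp theta) by rewrite mem_filter mem_index_enum andbT.
suff main (s : seq bip) (v : 'rV[C]_#|pidx n d|) : {subset s <= bip_supp theta} ->
    is_sym v -> (forall c, c \in bip_supp theta ->
     (v <= alt_ker (rho n (side c)) (max_rows S (side c)))%MS) ->
    v *m \big[mulmx/1%:M]_(b <- s) proj_bip R d n b (l b) != 0 ->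
    {in s, forall b, (size (l b) <= max_rows S (side b))%N}.
  move=> nz b bs; apply: (main _ _ _ _ _ nz); rewrite ?ms0 //.
  - by move=> c; rewrite ms0.
  - exact: tensor_power_sym.
  - by move=> c _; apply: tensor_power_alt.
elim: s v => [|b s IH] v sub symv altv //; rewrite big_cons mulmxA => nz.
have bs : b \in bip_supp theta by apply: sub; rewrite mem_head.
have [sym' alt' sz] := proj_bip_inv lam bs (part b bs) symv altv.
move=> c; rewrite inE => /orP[/eqP->|cs]; last first.
  by apply: (IH _ _ sym' alt' nz) cs => x xs; apply: sub; rewrite inE xs orbT.
by apply: sz; apply: contraNneq nz => ->; rewrite mul0mx.
Qed.

Definition split_weight (theta : {ffun bip -> R}) := \sum_(b | bip_splits b) theta b.

Lemma split_weight_supp theta :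
  split_weight theta = \sum_(b in bip_supp theta) theta b * (bip_splits b)%:R.
Proof.
rewrite /split_weight big_mkcond [RHS]big_mkcond /=; apply: eq_bigr => b _.
rewrite inE; case: (bip_splits b); rewrite ?mulr1 ?mulr0 ?if_same //.
by case: eqP => // ->.
Qed.

Lemma upper_functional_elt_le n (theta : {ffun bip -> R}) (l : bip -> seq nat) :
  (0 < n)%N -> lam_distr theta ->
  {in bip_supp theta, forall b, is_partition_of n (l b)} ->
  psi n *m \big[mulmx/1%:M]_(b in bip_supp theta) proj_bip R d n b (l b) != 0 ->
  \sum_(b in bip_supp theta) theta b * entropy R n (l b) <= split_weight theta.
Proof.
move=> n0 lam part nz; rewrite split_weight_supp; apply: ler_sum => b bs.
have [pos _ _] := lam; apply: ler_wpM2l; first exact: pos.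
have := tuple_few_rows lam part nz bs.
have [e1 e2] := entropy_few_rows R n0 (part b bs).
by rewrite /max_rows -/(bip_splits b); case: (bip_splits b) => [/e2|/e1->].
Qed.

Lemma tensor_power_neq0 n : psi n != 0.
Proof.
apply: contraTneq isT => p0; have := @tensor_powerE R k S n (enum_rank (diag S (finset.set0 : {set 'I_n}))).
rewrite p0 mxE enum_rankK (bigD1 finset.set0) //= eqxx => /eqP.
by rewrite eq_sym paddr_eq0 ?ler01 ?sumr_ge0 // oner_eq0.
Qed.

(** Two rows with second row between (N - 1) m and N m, out of 2 N m boxes:
    the proportion of the second row is within 1 / 2 N of 1/2. *)
Definition good_shapes N m (b : bip) : seq (seq nat) :=
  let n := (2 * N * m)%N in
  if bip_splits b then
    [seq [:: n - j; j]%N | j <- iota (N.-1 * m).+1 (N * m - N.-1 * m)]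
  else [:: [:: n]].

Lemma good_shapes_norm N m (b : bip) D : (0 < N)%N -> (0 < m)%N ->
  (#|small_sets (2 * N * m) (N.-1 * m)| * (2 * N * m).+1 * D ^ 2 <= 2 ^ (2 * N * m))%N ->
  let n := (2 * N * m)%N in
  let A := \sum_(l <- good_shapes N m b) proj_bip R d n b l in
  contraction A /\ hnrm (psi n - psi n *m A) * D%:R <= hnrm (psi n).
Proof.
move=> N0 m0 rare n A.
have nE : n = (N * m + N * m)%N by rewrite /n; lia.
have w0N : (N.-1 * m < N * m)%N by rewrite ltn_mul2r m0 prednK /=.
have uT := @leg_repr_unitary C k d n (side b).
pose P l := proj_ortho (isotypic_mx (rho n (side b)) l).
have AE : A = proj_sym R d n *m \sum_(l <- good_shapes N m b) P l.
  by rewrite mulmx_sumr.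
have psiA : psi n *m A = psi n *m \sum_(l <- good_shapes N m b) P l.
  rewrite AE mulmxA proj_ortho_id //; apply/is_symP; exact: tensor_power_sym.
have PP l : P l *m P l = P l by apply: proj_ortho_proj.
have Ph l : (P l)^t* = P l by apply: proj_ortho_trC.
suff [cP nP] : contraction (\sum_(l <- good_shapes N m b) P l) /\
    hnrm (psi n - psi n *m A) * D%:R <= hnrm (psi n).
  split; last exact: nP.
  by rewrite AE; exact: contractionM (proj_ortho_contraction _) cP.
rewrite psiA /good_shapes; case: ifP => sp; last first.
  rewrite big_seq1; split; first exact: proj_ortho_contraction.
  have -> : psi n *m P [:: n] = psi n.
    apply: proj_ortho_id; apply: fixed_isotypic => [|s]; first by rewrite nE; lia.
    by apply: tensor_power_nonsplit; rewrite -/(bip_splits b) sp.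
  by rewrite subrr /hnrm dotmxE mul0mx mxE sqrtC0 mul0r sqrtC_ge0 dnorm_ge0.
set G := iota _ _; have GE : {in G, forall j, (j <= n - j)%N}.
  by move=> j; rewrite mem_iota nE; lia.
rewrite -/n big_map.
have us : uniq G by apply: iota_uniq.
have PP0 : {in G &, forall i j, i != j -> P [:: n - i; i]%N *m P [:: n - j; j]%N = 0}.
  by move=> i j iG jG ij; apply: two_row_proj_ortho0; rewrite ?GE.
have [idem herm] := sum_proj us (fun j => PP [:: n - j; j]%N) (fun j => Ph _) PP0.
split; first exact: proj_herm_contraction.
have Gall j : (N.-1 * m < j)%N -> (j <= n - j)%N -> j \in G.
  by rewrite mem_iota nE; lia.
have := @good_part_norm R k S n (side b) sp G _ (iota_uniq _ _) GE Gall.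
rewrite /= => bound.
have D0 : 0 <= D%:R :> C by [].
rewrite -[D%:R]sqrCK // /hnrm -rootCMl ?dnorm_ge0 //.
rewrite ler_sqrtC ?qualifE /= ?mulr_ge0 ?dnorm_ge0 ?exprn_ge0 //.
rewrite (sqr_norm_tensor_power R n sp) -natrX.
apply: le_trans (ler_wpM2r _ bound) _ => //.
by rewrite -natrM ler_nat.
Qed.


Lemma good_shapes_neq0 N m b : (0 < N)%N -> (0 < m)%N -> good_shapes N m b != [::].
Proof.
move=> N0 m0; rewrite /good_shapes; case: ifP => // _.
by rewrite -size_eq0 size_map size_iota -mulnBl; case: N N0 => // N _ /=; rewrite subSnn mul1n -lt0n.
Qed.

Lemma good_shapesP N m b l : (0 < N)%N -> (0 < m)%N -> l \in good_shapes N m b ->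
  is_partition_of (2 * N * m) l /\
  (bip_splits b)%:R * (1 - (N%:R^-1) ^+ 2 / ln 2) <= entropy R (2 * N * m) l.
Proof.
move=> N0 m0; set n := (2 * N * m)%N; have n0 : (0 < n)%N by rewrite /n; nia.
rewrite /good_shapes -/n; case: (bip_splits b) => [/mapP[j]|]; last first.
  rewrite inE => /eqP->; rewrite mul0r entropy_one_row //; split=> //.
  by rewrite /is_partition_of /= addn0 eqxx inE andbT eq_sym -lt0n.
rewrite mem_iota => jG ->.
have nE : n = (N * m + N * m)%N by rewrite /n; lia.
have w0N : (N.-1 * m < N * m)%N by rewrite ltn_mul2r m0 prednK /=.
have [j0 jN] : (0 < j)%N /\ (j <= N * m)%N by lia.
have jn : (j <= n - j)%N by lia.
split.
  rewrite /is_partition_of /= addn0 subnK ?eqxx ?andbT; last by lia.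
  by rewrite jn /= !inE negb_or ![0%N == _]eq_sym -!lt0n j0; lia.
rewrite mul1r; have nR : 0 < n%:R :> R by rewrite ltr0n.
have NR : 0 < N%:R :> R by rewrite ltr0n.
apply: entropy_two_rows_ge; rewrite ?subnK //; try lia.
  rewrite subr_ge0 mulrA ler_pdivrMr // mul1r -natrM ler_nat; lia.
rewrite lerBlDr -lerBlDl mulrA ler_pdivlMr // -natrM.
have -> : (1 - N%:R^-1) * n%:R = (N.-1 * m)%:R * 2 :> R.
  have NE : N.-1%:R = N%:R - 1 :> R by rewrite -subn1 natrB.
  by rewrite /n !natrM NE; field; rewrite gt_eqF.
by rewrite -natrM ler_nat; lia.
Qed.

Lemma upper_functional_elt_ge (theta : {ffun bip -> R}) N : (0 < N)%N -> lam_distr theta ->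
  exists (n : nat) (l : bip -> seq nat), [/\ (0 < n)%N,
    {in bip_supp theta, forall b, is_partition_of n (l b)},
    psi n *m \big[mulmx/1%:M]_(b in bip_supp theta) proj_bip R d n b (l b) != 0 &
    split_weight theta - (N%:R^-1) ^+ 2 / ln 2
      <= \sum_(b in bip_supp theta) theta b * entropy R n (l b)].
Proof.
move=> N0 [pos tot _]; pose D := #|{: bip}|.+1.
have [m m0 rare] := small_sets_rare R (D ^ 2) N0.
pose n := (2 * N * m)%N; have n0 : (0 < n)%N by rewrite /n; nia.
pose A b := \sum_(l <- good_shapes N m b) proj_bip R d n b l.
have AP b : contraction (A b) /\ hnrm (psi n - psi n *m A b) * D%:R <= hnrm (psi n).
  exact: (good_shapes_norm b N0 m0 rare).
pose s0 := [seq b <- index_enum bip | b \in bip_supp theta].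
have DC : 0 < D%:R :> C by rewrite ltr0n.
have psi0 : 0 < hnrm (psi n) by rewrite sqrtC_gt0 dnorm_gt0 tensor_power_neq0.
have nz : psi n *m \big[mulmx/1%:M]_(b <- s0) A b != 0.
  apply/eqP => z; have := @hnrm_telescope C _ _ s0 A (psi n) (hnrm (psi n) / D%:R)
    (fun b => (AP b).1) (fun b => _).
  rewrite z subr0 => H; have {H} : hnrm (psi n) <= (size s0)%:R * (hnrm (psi n) / D%:R).
    by apply: H => b; rewrite ler_pdivlMr // (AP b).2.
  rewrite mulrA ler_pdivlMr // mulrC ler_pM2r // ler_nat leqNgt ltnS.
  by rewrite size_filter (leq_trans (count_size _ _)) // /index_enum -enumT -cardT.
have us0 : uniq s0 by rewrite filter_uniq // index_enum_uniq.
have [l lG nzl] := choose_factors us0 nz (fun b => good_shapes_neq0 b N0 m0).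
exists n, l; split; first exact: n0.
- by move=> b _; have [] := good_shapesP N0 m0 (lG b).
- by rewrite -big_filter.
rewrite split_weight_supp.
have e0 : 0 <= (N%:R^-1) ^+ 2 / ln 2 :> R.
  by apply: divr_ge0; [rewrite exprn_ge0 // invr_ge0 | exact/ltW/ln2_gt0].
apply: le_trans (_ : \sum_(b in bip_supp theta)
    theta b * ((bip_splits b)%:R * (1 - (N%:R^-1) ^+ 2 / ln 2)) <= _); last first.
  apply: ler_sum => b _; apply: ler_wpM2l; first exact: pos.
  by have [] := good_shapesP N0 m0 (lG b).
under [leRHS]eq_bigr do rewrite mulrA mulrBr mulr1.
rewrite sumrB lerD2l lerN2 -mulr_suml -split_weight_supp.
rewrite -[leRHS]mul1r ler_wpM2r // -tot /split_weight [leRHS](bigID bip_splits) /=.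
by rewrite lerDl sumr_ge0.
Qed.

Theorem upper_functional_unit (theta : {ffun bip -> R}) : lam_distr theta ->
  upper_functional theta (@unit_tensor R k S) = split_weight theta.
Proof.
move=> lam; rewrite /upper_functional; set E := (X in sup X).
have ubE : ubound E (split_weight theta).
  by move=> h [n [l [n0 part nz ->]]]; apply: upper_functional_elt_le.
have nearE N : (0 < N)%N -> exists2 h, E h & split_weight theta - (N%:R^-1) ^+ 2 / ln 2 <= h.
  move=> N0; have [n [l [n0 part nz le]]] := upper_functional_elt_ge N0 lam.
  by exists (\sum_(b in bip_supp theta) theta b * entropy R n (l b)) => //; exists n, l.
apply/eqP; rewrite eq_le; apply/andP; split.
  by apply: ge_sup => //; have [h Eh _] := nearE 1%N isT; exists h.
apply/ler_addgt0Pr => e e0.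
pose N := (Num.truncn (e * ln 2)^-1).+1.
have l0 := ln2_gt0 R; have el0 : 0 < e * ln 2 by rewrite mulr_gt0.
have [h Eh hge] := nearE N isT.
have hsup : h <= sup E by apply: ub_le_sup => //; exists (split_weight theta).
have Ne : (N%:R^-1) ^+ 2 / ln 2 <= e.
  rewrite ler_pdivrMr //; have N1 : (e * ln 2)^-1 < N%:R by apply: Num.Theory.truncnS_gt.
  have NR : 0 < N%:R :> R by rewrite ltr0n.
  have : N%:R^-1 <= e * ln 2 by rewrite -[e * _]invrK lef_pV2 ?posrE ?invr_gt0 // ltW.
  apply: le_trans; rewrite expr2 -[leRHS]mul1r; apply: ler_wpM2r.
    by rewrite invr_ge0 ltW.
  by rewrite invf_le1 // ler1n.
by rewrite -lerBlDr; lra.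
Qed.

End Functional.

Section Injectivity.
Variables (R : realType) (k : nat).
Local Notation bip := (bipartition k).
Implicit Types (S T : {set 'I_k}) (D : {ffun bip -> R}).

Lemma bip_mem_inj (b c : bip) T : T \in val b -> T \in val c -> b = c.
Proof.
have [_ _ bE] := sideP b; have [_ _ cE] := sideP c.
have H (e : bip) : val e = [set side e; ~: side e]%SET -> T \in val e -> val e = [set T; ~: T]%SET.
  move=> eE; rewrite {1}eE !inE eE => /orP[]/eqP-> //.
  by rewrite setCK finset.setUC.
by move=> /(H b bE) Tb /(H c cE) Tc; apply: val_inj; rewrite Tb Tc.
Qed.

(** A nonempty S lies in at most one side of b, and lies in one exactly when b
    does not split S. *)
Lemma nonsplit_count (b : bip) S : S != finset.set0 ->
  (1 - (bip_splits S b)%:R : R) = \sum_(T in val b | S \subset T) 1.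
Proof.
move=> S0; have [s0 sT bE] := sideP b.
have sC : side b != ~: side b.
  by apply: contraNneq s0 => E; rewrite -(finset.setIid (side b)) {2}E finset.setICr.
rewrite bE big_mkcondr /= big_setU1 ?inE //= big_set1.
rewrite /bip_splits /splits -!finset.setD_eq0 !finset.setDE setCK.
rewrite andbC; case: eqP => [E1|_]; case: eqP => [E2|_] /=; rewrite ?subrr ?subr0 ?addr0 ?add0r //.
case/eqP: S0; rewrite -(finset.setIT S) -(finset.setUCr (side b)) finset.setIUr.
by rewrite E1 E2 finset.setU0.
Qed.

(** By nonsplit_count the sum runs over the sets T containing S, counted with
    the value of D at their bipartition.  In descending induction on S only
    T = S is left. *)
Lemma split_weight_inj D : (forall S, S != finset.set0 ->
    \sum_b D b * (1 - (bip_splits S b)%:R) = 0) -> forall b, D b = 0.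
Proof.
move=> D0.
have main S : S != finset.set0 -> forall b : bip, S \in val b -> D b = 0.
  move: {2}(#|~: S|) (leqnn #|~: S|) => c; elim: c S => [|c IH] S Sc S0 b Sb.
    have [s0 sT bE] := sideP b; move: Sb Sc; rewrite bE !inE leqn0 cards_eq0.
    case/orP => /eqP->; rewrite ?setCK; last by rewrite (negPf s0).
    by rewrite -(inj_eq (inv_inj (@setCK _))) setCK finset.setC0 (negPf sT).
  have := D0 S S0; rewrite (bigD1 b) //= big1 ?addr0 => [|e eb].
    rewrite nonsplit_count // (bigD1 S) /=; last by rewrite Sb subxx.
    move/eqP; rewrite mulf_eq0 => /orP[/eqP//|].
    by rewrite gt_eqF // ltr_pwDl // sumr_ge0.
  have [->|De] := eqVneq (D e) 0; first by rewrite mul0r.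
  rewrite nonsplit_count // big_pred0 ?mulr0 // => T; apply/negP => /andP[Te ST].
  have [TS|TS] := eqVneq T S.
    by case/eqP: eb; apply: (bip_mem_inj (T := S)) Sb; rewrite -TS.
  have T0 : T != finset.set0.
    by apply: contraNneq S0 => T0; rewrite T0 finset.subset0 in ST.
  case/eqP: De; apply: (IH T) => //.
  rewrite -ltnS; apply: leq_trans Sc; apply: proper_card.
  by rewrite finset.properC finset.properEneq eq_sym TS ST.
by move=> b; have [s0 _ bE] := sideP b; apply: (main (side b)); rewrite // bE !inE eqxx.
Qed.
End Injectivity.

Theorem lemma4p16 (R : realType) (k : nat) :
  set_inj (@lam_distr R k)
    (fun theta : {ffun bipartition k -> R} =>
       [ffun S : proper_subset k =>
          upper_functional theta (@unit_tensor R k (val S))]).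
Proof.
move=> th1 th2 /set_mem l1 /set_mem l2 /ffunP eqE.
have eqW S : S != finset.set0 -> S != [set: 'I_k]%SET ->
    split_weight S th1 = split_weight S th2.
  move=> S0 ST; have SP : (S != finset.set0) && (S != [set: 'I_k]%SET) by rewrite S0.
  by have := eqE (Sub S SP); rewrite !ffunE !upper_functional_unit.
have [_ tot1 _] := l1; have [_ tot2 _] := l2.
have D0 := @split_weight_inj R k [ffun b => th1 b - th2 b].
apply/ffunP => b; apply/eqP; rewrite -subr_eq0; apply/eqP.
have := D0 _ b; rewrite ffunE; apply=> S S0.
have [->|ST] := eqVneq S [set: 'I_k]%SET.
  rewrite big1 // => c _; have [s0 sT _] := sideP c.
  suff -> : bip_splits [set: 'I_k]%SET c by rewrite subrr mulr0.
  rewrite /bip_splits /splits !finset.setTI s0 /=.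
  by apply: contra_neq sT => /(congr1 (@finset.setC _)); rewrite setCK finset.setC0.
have WE (th : {ffun bipartition k -> R}) :
    \sum_c th c * (1 - (bip_splits S c)%:R) = \sum_c th c - split_weight S th.
  rewrite /split_weight [X in _ - X]big_mkcond -sumrB; apply: eq_bigr => c _.
  by case: (bip_splits S c); rewrite ?subrr ?subr0 ?mulr0 ?mulr1.
under eq_bigr do rewrite ffunE mulrBl.
by rewrite sumrB !WE tot1 tot2 eqW // subrr.
Qed.
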